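(* Let $a>0$, let $k\in\mathbb{N}^*$ and $k_b\in\mathbb{N}$, let $\lambda>0$, let $r,p\ge 1$ be integers, and let $a_{-r},\dots,a_p$ be real numbers with $a_{-r}\,a_p\neq0$ satisfying $$\forall\, m=0,\dots,k,\quad \sum_{\ell=-r}^p \ell^m a_\ell=(-\lambda a)^m,\qquad\text{and}\qquad \sup_{\theta\in[0,2\pi]}\Big|\sum_{\ell=-r}^p a_\ell\, e^{i\ell\theta}\Big|\le 1 .$$ Let $k_0:=\min(k,k_b)$. Then there exists $C>0$ such that for any $T>0$ and $J\in\mathbb{N}^*$, for any $L\ge1$, and for any $u_0\in H^{k+1}((-\infty,L))$, the following holds. Set $\Delta x=L/J$ and $\Delta t=\lambda\,\Delta x$ (assumed to be less than $1$), $x_j=j\,\Delta x$ and $t^n=n\,\Delta t$. The solution $(u_j^n)$ to $$\begin{cases} u_j^0=\dfrac{1}{\Delta x}\displaystyle\int_{x_{j-1}}^{x_j}u_0(y)\,dy, & j\le J,\\[2mm] (D_-^{k_b}u^n)_{J+\ell}=0, & 0\le n\le T/\Delta t-1,\ \ell=1,\dots,p,\\ u_j^{n+1}=\displaystyle\sum_{\ell=-r}^p a_\ell\,u_{j+\ell}^n, & 0\le n\le T/\Delta t-1,\ j\le J, \end{cases}$$ satisfies $$\sup_{0\le n\le T/\Delta t}\left(\sum_{j\le J}\Delta x\left(u_j^n-\frac{1}{\Delta x}\int_{x_{j-1}}^{x_j}u_0(y-a\,t^n)\,dy\right)^2\right)^{1/2}\le C\,(\sqrt{T}+T)\,\Delta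 x^{k_0}\,\|u_0\|_{H^{k_0+1}((-\infty,L))}.$$ In particular, the following global $\ell^\infty$ convergence estimate is satisfied: $$\sup_{0\le n\le T/\Delta t}\ \sup_{j\le J}\left|u_j^n-\frac{1}{\Delta x}\int_{x_{j-1}}^{x_j}u_0(y-a\,t^n)\,dy\right|\le C\,(\sqrt{T}+T)\,\Delta x^{k_0-1/2}\,\|u_0\|_{H^{k_0+1}((-\infty,L))}.$$
   Context: $\mathbb{N}=\{0,1,2,\dots\}$, $\mathbb{N}^*=\mathbb{N}\setminus\{0\}$. The index $j$ runs over integers; $j\le J$ are interior cells $(x_{j-1},x_j)$ of $(-\infty,L)$ and $J+1,\dots,J+p$ are ghost cells. $D_-$ is the backward difference operator $(D_-v)_j=v_j-v_{j-1}$ acting on sequences $(v_j)_{j\le J+p}$, $D_-^m$ its $m$-th iterate, $D_-^0$ the identity. At each time level the ghost values $u_{J+1}^n,\dots,u_{J+p}^n$ are determined successively from the boundary conditions. The constant $C$ may depend on $a,\lambda,k,k_b,r,p$ and the coefficients $a_\ell$, but not on $T,J,L,u_0$. *)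

(* Defs.v *)
From HB Require Import structures.
From mathcomp Require Import all_boot all_order all_algebra.
From mathcomp Require Import complex.
From mathcomp Require Import all_classical all_reals all_analysis.

Set Implicit Arguments.
Unset Strict Implicit.
Unset Printing Implicit Defensive.

Import Order.TTheory GRing.Theory Num.Theory.
Import numFieldNormedType.Exports.

Local Open Scope classical_set_scope.
Local Open Scope ring_scope.

Section Sobolev.
Variable R : realType.
Implicit Types (Omega : set R) (u g phi : R -> R) (m : nat).

Let mu := @lebesgue_measure R.

(* C_c^oo(Omega) *)
Definition test_function Omega phi : Prop :=
  [/\ forall n x, derivable (phi^`(n)%classic) x 1,
      compact (closure [set x | phi x != 0])
    & closure [set x | phi x != 0] `<=` Omega].

Definition is_weak_derivative Omega m u g : Prop :=
  locally_integrable Omega g /\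
  forall phi, test_function Omega phi ->
    (\int[mu]_(x in Omega) (u x * phi^`(m)%classic x) =
     (-1) ^+ m * \int[mu]_(x in Omega) (g x * phi x))%R.

(* Weak derivatives are unique almost everywhere on Omega, so the representative
   chosen here does not affect the norm below. *)
Definition weak_derivative Omega m u : R -> R :=
  xget (cst 0) [set g | is_weak_derivative Omega m u g].

Definition in_L2 Omega u : Prop := (u \_ Omega) \in Lfun mu 2%:E.

(* u \in H^m(Omega); the values of u outside Omega are irrelevant *)
Definition in_sobolev Omega m u : Prop :=
  in_L2 Omega u /\
  forall i, (i <= m)%N ->
    exists2 g, is_weak_derivative Omega i u g & in_L2 Omega g.

Definition sobolev_norm Omega m u : \bar R :=
  ((\sum_(i < m.+1)
      'N[mu]_2%:E [EFin \o (weak_derivative Omega i u) \_ Omega] ^+ 2)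
    `^ 2^-1)%E.

End Sobolev.

Section Scheme.
Variable R : realType.

(* the integers -r, ..., p *)
Definition stencil (r p : nat) : seq int :=
  [seq i%:Z - r%:Z | i <- iota 0 (r + p).+1].

(* e^{i theta} *)
Definition expi (theta : R) : R[i] := (cos theta +i* sin theta)%C.

Definition symbol (r p : nat) (a_ : int -> R) (theta : R) : R[i] :=
  \sum_(l <- stencil r p) (a_ l)%:C%C * expi (l%:~R * theta).

Definition backward_diff (v : int -> R) : int -> R := fun j => v j - v (j - 1).

(* average over the cell (x_{j-1}, x_j), with x_j = j dx *)
Definition cell_average (dx : R) (f : R -> R) (j : int) : R :=
  dx^-1 * (\int[@lebesgue_measure R]_(y in `](j - 1)%:~R * dx, j%:~R * dx[) f y)%R.

(* u n j is u_j^n; only the values with j <= J + p are constrained. *)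
Definition scheme_solution (kb r p : nat) (a_ : int -> R) (T dt dx : R) (J : nat)
    (u0 : R -> R) (u : nat -> int -> R) : Prop :=
  [/\ forall j : int, j <= J%:Z -> u 0%N j = cell_average dx u0 j,
      forall (n l : nat), n%:R <= T / dt - 1 -> (1 <= l <= p)%N ->
        iter kb backward_diff (u n) (J%:Z + l%:Z) = 0
    & forall (n : nat) (j : int), n%:R <= T / dt - 1 -> j <= J%:Z ->
        u n.+1 j = \sum_(l <- stencil r p) a_ l * u n (j + l)].

End Scheme.

(* Main.v *)
Require Import Defs.
From HB Require Import structures.
From mathcomp Require Import all_boot all_order all_algebra.
From mathcomp Require Import complex.
From mathcomp Require Import all_classical all_reals all_analysis.
From mathcomp Require Import measurable_realfun.
From mathcomp Require Import ring lra zify.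

Set Implicit Arguments.
Unset Strict Implicit.
Unset Printing Implicit Defensive.

Import Order.TTheory GRing.Theory Num.Theory.
Import numFieldNormedType.Exports.

Local Open Scope classical_set_scope.
Local Open Scope ring_scope.

(** The error between the numerical solution and the cell means of the exact
    solution solves the same scheme, with the truncation error as a source in
    the interior cells and with a defect in the boundary condition. The theorem
    holds because the scheme is stable with respect to both, and because both
    are small.

    Stability. A symbol of modulus at most one makes the scheme a contraction
    of the square-summable sequences of the whole line
    ([scheme_step_contraction]). On the half-line, a sequence is extended to the
    right before the contraction is applied. When the ghost values are
    prescribed, one extends by zero: what the scheme pushes out of the domain is
    lost for the energy and, since [a_(-r)] does not vanish, controls the last
    values of the sequence ([dirichlet_energy]). In general, one extends a
    sequence [w] by [w_J] times a long ramp. The scheme moves it to the right at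
    a positive speed, by the consistency of order one, and a decreasing ramp
    gains energy in this way; this controls [w_J] up to the values of [D_- w]
    near the boundary ([neumann_energy]). All the differences [D_-^i e] of a
    solution solve the scheme, and the ghost values of the difference of order
    [k_b] are prescribed, so a weighted sum of the energies of these differences
    decreases up to the boundary data ([energy_estimate]). Over [T / dt] steps
    the squares of the boundary data add up, which gives the factor [sqrt T],
    while the interior sources themselves add up, which gives the factor [T]
    ([stability]).

    Regularity. Let [u] have the weak derivative [g]. The mean of [u] over a
    moving cell of fixed length is differentiable in the classical sense, and
    its derivative is the mean of [g] ([is_derive_cell_mean]). This comes from
    testing against primitives of differences of smooth plateaus, which compare
    the integrals of [u] over two translated intervals
    ([weak_derivative_increment]). Taylor's formula therefore applies to the
    exact cell means up to the boundary, and its remainder is bounded by the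
    energy of the last derivative in a few cells.

    Consistency. The exact means are prolonged to the ghost cells by their
    Taylor polynomial of degree [k0] at the boundary. The moment conditions make
    the scheme exact on polynomials of degree at most [k], hence the truncation
    error is of order [k0 + 1] ([truncation_error]), and its square sum is
    bounded by the energy of the derivative of order [k0 + 1] because the
    stencils overlap boundedly ([sum_window_le]). The difference of order [k_b]
    annihilates polynomials of degree less than [k0], so the defect of the
    boundary condition is of order [dx^k0] times the supremum of the derivative
    of order [k0] ([ghost_difference]), which the Sobolev norm controls
    ([discrete_sobolev]). *)

(** * Contraction on the whole line *)

Section Parseval.
Variable R : realType.
Implicit Types (c : nat -> R) (M d : nat).

Lemma sum_cos_roots_of_unity M d : (0 < d < M)%N ->
  \sum_(k < M) cos (k%:R * (d%:R * (2 * pi / M%:R))) = 0 :> R.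
Proof.
move=> /andP[d0 dM].
have M0 : (M%:R : R) != 0 by rewrite pnatr_eq0; lia.
set phi : R := d%:R * _.
have phiM : M%:R * phi = pi *+ 2 *+ d.
  by rewrite /phi -mulrnA -[pi *+ _]mulr_natr natrM; field.
have sin_gt0 : 0 < sin (phi / 2).
  apply: sin_gt0_pi.
  have MV0 : 0 < (M%:R : R)^-1 by rewrite invr_gt0 ltr0n; lia.
  have dV0 : 0 < (d%:R : R) by rewrite ltr0n.
  have -> : phi / 2 = (d%:R * M%:R^-1) * pi by rewrite /phi; field.
  rewrite !mulr_gt0 ?pi_gt0//= -[ltRHS]mul1r ltr_pM2r ?pi_gt0//.
  by rewrite ltr_pdivrMr ?mul1r ?ltr_nat// ltr0n; lia.
have telescope k : 2 * sin (phi / 2) * cos (k%:R * phi) =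
    sin (k.+1%:R * phi - phi / 2) - sin (k%:R * phi - phi / 2).
  rewrite (_ : k.+1%:R * phi - _ = k%:R * phi + phi / 2); last first.
    by rewrite -natr1; field.
  rewrite sinD sinB; ring.
apply: (mulfI (lt0r_neq0 (mulr_gt0 (ltr0Sn R 1) sin_gt0))).
rewrite mulr0 mulr_sumr; under eq_bigr do rewrite telescope.
rewrite -(big_mkord xpredT
  (fun k => sin (k.+1%:R * phi - phi / 2) - sin (k%:R * phi - phi / 2))).
rewrite (telescope_sumr (fun k => sin (k%:R * phi - phi / 2))) //.
by rewrite phiM [_ *+ d - _]addrC (periodicn (@sinD2pi R)) sinN mul0r sub0r sinN opprK addNr.
Qed.

Lemma cos_sub_root M (i j : nat) (k : nat) :
  cos (i%:R * (k%:R * (2 * pi / M%:R)) - j%:R * (k%:R * (2 * pi / M%:R))) =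
  cos (k%:R * ((maxn i j - minn i j)%:R * (2 * pi / M%:R))) :> R.
Proof.
case: (leqP i j) => ij.
  rewrite -cosN natrB //; congr cos; ring.
rewrite natrB 1?ltnW //; congr cos; ring.
Qed.

(** Parseval's identity on [Z/M]. In terms of cosines and sines, everything
    reduces to the vanishing of [sum_cos_roots_of_unity]. *)
Lemma parseval c M :
  \sum_(k < M) ((\sum_(i < M) c i * cos (i%:R * (k%:R * (2 * pi / M%:R)))) ^+ 2
    + (\sum_(i < M) c i * sin (i%:R * (k%:R * (2 * pi / M%:R)))) ^+ 2)
  = M%:R * \sum_(i < M) c i ^+ 2.
Proof.
have expand k : (\sum_(i < M) c i * cos (i%:R * (k%:R * (2 * pi / M%:R)))) ^+ 2
    + (\sum_(i < M) c i * sin (i%:R * (k%:R * (2 * pi / M%:R)))) ^+ 2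
  = \sum_(i < M) \sum_(j < M) c i * c j *
      cos (k%:R * ((maxn i j - minn i j)%:R * (2 * pi / M%:R))).
  rewrite !expr2 !big_distrlr -big_split /=; apply: eq_bigr => i _.
  rewrite -big_split /=; apply: eq_bigr => j _.
  rewrite -cos_sub_root cosB; ring.
under eq_bigr do rewrite expand; rewrite exchange_big mulr_sumr /=.
apply: eq_bigr => i _; rewrite exchange_big (bigD1 i) //= [X in _ + X]big1 ?addr0.
  rewrite maxnn minnn subnn; under eq_bigr do rewrite mul0r mulr0 cos0 mulr1.
  by rewrite sumr_const card_ord -expr2 mulr_natl.
move=> j ji; rewrite -mulr_sumr sum_cos_roots_of_unity ?mulr0 //.
have := ltn_ord i; have := ltn_ord j.
move: ji; rewrite -val_eqE /= => /eqP; lia.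
Qed.

Lemma normc_sqr (x y : R) :
  ComplexField.Normc.normc (Complex x y) ^+ 2 = x ^+ 2 + y ^+ 2.
Proof. by rewrite /ComplexField.Normc.normc sqr_sqrtr // addr_ge0 ?sqr_ge0. Qed.

End Parseval.

Section Contraction.
Variables (R : realType) (r p : nat) (a_ : int -> R).
Implicit Types (w : int -> R).

Definition scheme_step w : int -> R :=
  fun j => \sum_(l <- stencil r p) a_ l * w (j + l).

Lemma big_stencil (S : nmodType) (F : int -> S) :
  \sum_(l <- stencil r p) F l = \sum_(i < (r + p).+1) F (i%:Z - r%:Z).
Proof.
by rewrite /stencil big_map -[iota _ _]/(index_iota 0 (r + p).+1) big_mkord.
Qed.

Lemma expiD (x y : R) : expi (x + y) = expi x * expi y.
Proof.
apply/eqP; rewrite eq_complex /expi /= cosD sinD eqxx /=; apply/eqP; ring.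
Qed.

Lemma normc_expi (x : R) : ComplexField.Normc.normc (expi x) = 1.
Proof. by rewrite /expi /= cos2Dsin2 sqrtr1. Qed.

Definition fourier (M : nat) (c : nat -> R) (theta : R) : R[i] :=
  \sum_(i < M) (c i)%:C%C * expi (i%:R * theta).

Lemma complex_sum (I : Type) (s : seq I) (x y : I -> R) :
  \sum_(i <- s) Complex (x i) (y i) =
  Complex (\sum_(i <- s) x i) (\sum_(i <- s) y i).
Proof.
elim: s => [|i s IH]; first by rewrite !big_nil.
by rewrite !big_cons IH; apply/eqP; rewrite eq_complex /= !eqxx.
Qed.

Lemma normc_fourier M c theta :
  ComplexField.Normc.normc (fourier M c theta) ^+ 2 =
  (\sum_(i < M) c i * cos (i%:R * theta)) ^+ 2
    + (\sum_(i < M) c i * sin (i%:R * theta)) ^+ 2.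
Proof.
rewrite -normc_sqr -complex_sum /fourier.
under eq_bigr => i _.
  have -> : (c i)%:C%C * expi (i%:R * theta) =
      Complex (c i * cos (i%:R * theta)) (c i * sin (i%:R * theta)).
    by apply/eqP; rewrite eq_complex /expi /= !mul0r subr0 addr0 !eqxx.
  over.
by [].
Qed.

Lemma parseval_fourier M c :
  \sum_(k < M) ComplexField.Normc.normc (fourier M c (k%:R * (2 * pi / M%:R))) ^+ 2
  = M%:R * \sum_(i < M) c i ^+ 2.
Proof. by rewrite -parseval; apply: eq_bigr => k _; rewrite normc_fourier. Qed.

Hypothesis symbol_le1 : forall theta : R, 0 <= theta <= 2 * pi ->
  ComplexField.Normc.normc (symbol r p a_ theta) <= 1.

Lemma symbolE theta : expi (r%:R * theta) * symbol r p a_ theta =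
  fourier (r + p).+1 (fun i => a_ (i%:Z - r%:Z)) theta.
Proof.
rewrite /symbol big_stencil mulr_sumr; apply: eq_bigr => i _.
rewrite mulrCA -expiD; congr (_ * expi _).
by rewrite rmorphB /= -!pmulrn; ring.
Qed.


Lemma sum_shift (S : nmodType) (F : int -> S) (N M l : nat) :
  (N + l <= M)%N -> (forall z : int, z < 0 -> F z = 0) ->
  (forall z : int, N%:Z <= z -> F z = 0) ->
  \sum_(i < M) F (i%:Z - l%:Z) = \sum_(i < M) F i.
Proof.
move=> NlM Fneg Fbig.
rewrite -(big_mkord xpredT (fun i => F (i%:Z - l%:Z))).
rewrite -(big_mkord xpredT (fun i : nat => F i)).
rewrite (@big_cat_nat _ _ _ l) ?(leq_trans _ NlM) ?leq_addl //=.
rewrite [X in X + _]big_nat_cond [X in X + _]big1 ?add0r => [|i]; last first.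
  by rewrite andbT => /andP[_ il]; apply: Fneg; lia.
rewrite [RHS](@big_cat_nat _ _ _ (M - l)) ?leq_subr //=.
rewrite [X in _ = _ + X]big_nat_cond [X in _ = _ + X]big1 ?addr0 => [|i]; last first.
  by rewrite andbT => /andP[il _]; apply: Fbig; lia.
rewrite -{1}[l]add0n big_addn; apply: eq_big_nat => i _; congr F; lia.
Qed.

Lemma fourier_scheme_step (N : nat) (K : int) (w : int -> R) theta :
  (forall j, K < j -> w j = 0) -> (forall j, j <= K - N%:Z -> w j = 0) ->
  let M := (N + (r + p))%N in
  fourier M (fun i => scheme_step w (K + r%:Z - i%:Z)) theta =
  expi (r%:R * theta) * symbol r p a_ theta * fourier M (fun i => w (K - i%:Z)) theta.
Proof.
move=> wK wN M.
rewrite symbolE {1}/fourier /scheme_step.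
under eq_bigr => i _.
  rewrite big_stencil rmorph_sum mulr_suml.
  under eq_bigr => l _.
    have -> : (a_ (l%:Z - r%:Z) * w (K + r%:Z - i%:Z + (l%:Z - r%:Z)))%:C%C *
        expi (i%:R * theta) = ((a_ (l%:Z - r%:Z))%:C%C * expi (l%:R * theta)) *
        ((w (K - (i%:Z - l%:Z)))%:C%C * expi ((i%:Z - l%:Z)%:~R * theta)).
      rewrite rmorphM /= mulrACA -expiD; congr (_ * _%:C%C * expi _).
        by congr w; ring.
      rewrite rmorphB /= -!pmulrn; ring.
    over.
  over.
rewrite exchange_big /= /fourier mulr_suml; apply: eq_bigr => l _.
rewrite -mulr_sumr; congr (_ * _).
rewrite (@sum_shift _ (fun z => (w (K - z))%:C%C * expi (z%:~R * theta)) N) //.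
- by rewrite /M leq_add2l -ltnS.
- by move=> z z0; rewrite wK ?mul0r //; lia.
- by move=> z z0; rewrite wN ?mul0r //; lia.
Qed.

(** Since the symbol has modulus at most one, Parseval's identity makes the
    scheme a contraction of the square-summable sequences on the whole line. *)
Lemma scheme_step_contraction (N : nat) (K : int) (w : int -> R) :
  (forall j, K < j -> w j = 0) -> (forall j, j <= K - N%:Z -> w j = 0) ->
  \sum_(i < N + (r + p)) scheme_step w (K + r%:Z - i%:Z) ^+ 2
  <= \sum_(i < N) w (K - i%:Z) ^+ 2.
Proof.
move=> wK wN; set M := (N + (r + p))%N.
have -> : \sum_(i < N) w (K - i%:Z) ^+ 2 = \sum_(i < M) w (K - i%:Z) ^+ 2.
  rewrite /M big_split_ord /= [X in _ = _ + X]big1 ?addr0 // => i _.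
  by rewrite wN ?expr0n //; lia.
have [->|M0] := posnP M; first by rewrite !big_ord0.
have M0R : 0 < M%:R :> R by rewrite ltr0n.
rewrite -(ler_pM2l M0R).
rewrite -(parseval_fourier _ (fun i => scheme_step w (K + r%:Z - i%:Z))).
rewrite -(parseval_fourier _ (fun i => w (K - i%:Z))).
apply: ler_sum => k _; rewrite fourier_scheme_step //.
rewrite !ComplexField.Normc.normcM normc_expi mul1r exprMn.
rewrite ler_piMl ?sqr_ge0 // expr_le1 // ?symbol_le1 //; last first.
  by case: (symbol _ _ _ _) => x y; rewrite /= sqrtr_ge0.
have pi0 := pi_ge0 R.
rewrite !mulr_ge0 ?invr_ge0 ?ler0n //= mulrA ler_pdivrMr //.
by rewrite mulrC ler_wpM2l ?mulr_ge0 ?ler_nat // ltnW.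
Qed.

End Contraction.

(** * Energy estimates at the boundary *)

Section BoundaryEnergy.
Variables (R : realType) (r p : nat) (a_ : int -> R).
Implicit Types (w : int -> R) (J K : int) (M N : nat).

Local Notation T := (scheme_step r p a_).
Local Notation D := (@backward_diff R).

Definition sqnorm J M w : R := \sum_(i < M) w (J - i%:Z) ^+ 2.

(** The entries [w_(J-r+1), ..., w_(J+p)] are those shared by the stencils of
    cells on both sides of the boundary. *)
Definition bdry_values J w : R := \sum_(i < r + p) `|w (J + p%:Z - i%:Z)|.

Definition ghost_values J w : R := \sum_(i < p) `|w (J + p%:Z - i%:Z)|.

Definition coef_norm : R := \sum_(l <- stencil r p) `|a_ l|.

Lemma mem_stencil l : (l \in stencil r p) = (- r%:Z <= l <= p%:Z).
Proof.
apply/mapP/idP => [ [i ir ->]|/andP[rl lp] ].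
  by move: ir; rewrite mem_iota; lia.
by exists (absz (l + r%:Z)); [rewrite mem_iota|]; lia.
Qed.

Lemma coef_norm_ge0 : 0 <= coef_norm.
Proof. exact: sumr_ge0. Qed.

Lemma eq_scheme_step w w' j :
  (forall i, j - r%:Z <= i <= j + p%:Z -> w i = w' i) -> T w j = T w' j.
Proof.
move=> ww'; apply: eq_big_seq => l; rewrite mem_stencil => lrp.
by rewrite ww' //; lia.
Qed.

Lemma scheme_step_bound w j (B : R) :
  (forall i, j - r%:Z <= i <= j + p%:Z -> `|w i| <= B) ->
  `|T w j| <= coef_norm * B.
Proof.
move=> wB; rewrite mulr_suml (le_trans (ler_norm_sum _ _ _)) //.
rewrite big_seq [leRHS]big_seq; apply: ler_sum => l; rewrite mem_stencil => lrp.
by rewrite normrM ler_wpM2l // wB //; lia.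
Qed.

Lemma scheme_stepD w w' j : T (fun i => w i + w' i) j = T w j + T w' j.
Proof. by rewrite -big_split; apply: eq_bigr => l _; rewrite mulrDr. Qed.

Lemma scheme_stepZ c w j : T (fun i => c * w i) j = c * T w j.
Proof. by rewrite mulr_sumr; apply: eq_bigr => l _; rewrite mulrCA. Qed.

Lemma sqr_sum_le n (F : nat -> R) :
  (\sum_(i < n) F i) ^+ 2 <= n%:R * \sum_(i < n) F i ^+ 2.
Proof.
elim: n => [|n IH]; first by rewrite !big_ord0 mul0r expr0n.
rewrite !big_ord_recr /=; set s := \sum_(i < n) F i in IH *.
set q := \sum_(i < n) F i ^+ 2 in IH *; set x := F n.
have [n0|n0] := posnP n.
  by rewrite /s /q n0 !big_ord0 !add0r mul1r.
have q0 : 0 <= q by apply: sumr_ge0 => i _; exact: sqr_ge0.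
have n0R : 0 < n%:R :> R by rewrite ltr0n.
have : 0 <= n%:R * (q - s ^+ 2 / n%:R).
  by rewrite mulr_ge0 // ?ler0n // subr_ge0 ler_pdivrMr // mulrC.
have : 0 <= n%:R * (x - s / n%:R) ^+ 2 by rewrite mulr_ge0 ?sqr_ge0.
rewrite -natr1.
have -> : n%:R * (x - s / n%:R) ^+ 2 = n%:R * x ^+ 2 - 2 * x * s + s ^+ 2 / n%:R by field; lra.
have -> : n%:R * (q - s ^+ 2 / n%:R) = n%:R * q - s ^+ 2 by field; lra.
have : s ^+ 2 / n%:R <= q by rewrite ler_pdivrMr // mulrC.
nra.
Qed.

Lemma sum_sqr_le n (F : nat -> R) : (forall i, 0 <= F i) ->
  \sum_(i < n) F i ^+ 2 <= (\sum_(i < n) F i) ^+ 2.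
Proof.
move=> F0; elim: n => [|n IH]; first by rewrite !big_ord0 expr0n.
rewrite !big_ord_recr /= sqrrD; have := F0 n.
have : 0 <= \sum_(i < n) F i by apply: sumr_ge0.
nra.
Qed.

Hypothesis symbol_le1 : forall theta : R, 0 <= theta <= 2 * pi ->
  ComplexField.Normc.normc (symbol r p a_ theta) <= 1.

(** The scheme propagates by at most [r] cells to the right in one step, so
    that cutting a sequence off on the left turns the contraction property into
    an inequality between finite windows. *)
Lemma energy_cutoff J (S M : nat) w : (forall j, J + S%:Z < j -> w j = 0) ->
  sqnorm J M (T w) + \sum_(s < S + r) T w (J + S%:Z + r%:Z - s%:Z) ^+ 2
  <= sqnorm J (M + r) w + \sum_(s < S) w (J + S%:Z - s%:Z) ^+ 2.
Proof.
move=> wS.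
pose w' j := if j <= J - (M + r)%:Z then 0 else w j.
have w'S j : J + S%:Z < j -> w' j = 0 by move=> Sj; rewrite /w' wS ?if_same.
have w'M j : j <= J + S%:Z - (S + (M + r))%:Z -> w' j = 0.
  by move=> jM; rewrite /w' ifT //; lia.
have := scheme_step_contraction symbol_le1 w'S w'M.
have -> : (S + (M + r) + (r + p) = S + r + M + (r + p))%N by lia.
rewrite 2!big_split_ord /= [X in _ <= X -> _]big_split_ord /=.
set t1 := \sum_(i < S + r) _; set t2 := \sum_(i < M) _; set t3 := \sum_(i < r + p) _.
have t30 : 0 <= t3 by apply: sumr_ge0 => i _; exact: sqr_ge0.
have -> : t1 = \sum_(s < S + r) T w (J + S%:Z + r%:Z - s%:Z) ^+ 2.
  apply: eq_bigr => i _; congr (_ ^+ 2); apply: eq_scheme_step => j jr.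
  by rewrite /w' ifF //; have := ltn_ord i; lia.
have -> : t2 = sqnorm J M (T w).
  apply: eq_bigr => i _; congr (_ ^+ 2).
  have -> : J + S%:Z + r%:Z - (S + r + i)%N%:Z = J - i%:Z by lia.
  apply: eq_scheme_step => j jr.
  by rewrite /w' ifF //; have := ltn_ord i; lia.
move=> h; rewrite addrC (le_trans _ (le_trans h _)) ?lerDl //.
rewrite addrC lerD //.
  rewrite /sqnorm; apply: ler_sum => i _.
  rewrite (_ : J + S%:Z - (S + i)%N%:Z = J - i%:Z); last by lia.
  by rewrite /w'; case: ifP => // _; rewrite expr0n sqr_ge0.
apply: ler_sum => i _; rewrite /w'; case: ifP => // _.
by rewrite expr0n sqr_ge0.
Qed.

End BoundaryEnergy.

Section DirichletLevel.
Variables (R : realType) (r p : nat) (a_ : int -> R).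
Implicit Types (w : int -> R) (J K : int) (M N : nat).

Local Notation T := (scheme_step r p a_).
Local Notation D := (@backward_diff R).

Hypothesis ar_neq0 : a_ (- r%:Z) != 0.

Lemma scheme_stepE w j : T w j =
  a_ (- r%:Z) * w (j - r%:Z)
  + \sum_(q < r + p) a_ (q.+1%:Z - r%:Z) * w (j + (q.+1%:Z - r%:Z)).
Proof. by rewrite /scheme_step big_stencil big_ord_recl /= sub0r. Qed.

Lemma coef_normE : coef_norm r p a_ =
  `|a_ (- r%:Z)| + \sum_(q < r + p) `|a_ (q.+1%:Z - r%:Z)|.
Proof. by rewrite /coef_norm big_stencil big_ord_recl /= sub0r. Qed.

(** As [a_(-r)] does not vanish, the values that the scheme produces on the
    right of the support determine, triangularly, the last values of a
    sequence. *)
Lemma outflow_controls_trace n : exists2 C : R, 0 <= C &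
  forall K w, (forall j, K < j -> w j = 0) ->
    \sum_(i < n) `|w (K - i%:Z)|
    <= C * \sum_(i < n) `|T w (K + r%:Z - i%:Z)|.
Proof.
elim: n => [|n [C C0 IH]]; first by exists 0 => // K w _; rewrite !big_ord0 mulr0.
set b := `|a_ (- r%:Z)|^-1; set A := coef_norm r p a_.
have b0 : 0 <= b by rewrite invr_ge0.
have A0 : 0 <= A by exact: coef_norm_ge0.
exists (C + b * (1 + A * C)).
  by rewrite addr_ge0 // mulr_ge0 // addr_ge0 ?mulr_ge0.
move=> K w wK; rewrite !big_ord_recr /=.
have := IH K w wK.
set s := \sum_(i < n) `|w _|; set t := \sum_(i < n) `|T w _|.
have s0 : 0 <= s by apply: sumr_ge0.
have t0 : 0 <= t by apply: sumr_ge0.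
set y := T w (K + r%:Z - n%:Z).
have wn : `|w (K - n%:Z)| <= b * (`|y| + A * s).
  rewrite /b mulrC ler_pdivlMr ?normr_gt0 // -normrM.
  have -> : w (K - n%:Z) * a_ (- r%:Z) =
     y - \sum_(q < r + p) a_ (q.+1%:Z - r%:Z) * w (K + r%:Z - n%:Z + (q.+1%:Z - r%:Z)).
    rewrite /y scheme_stepE addrK mulrC; congr (_ * w _); lia.
  rewrite (le_trans (ler_normB _ _)) // lerD2l.
  rewrite (le_trans (ler_norm_sum _ _ _)) // /A coef_normE mulrDl.
  rewrite ler_wpDl ?mulr_ge0 // mulr_suml; apply: ler_sum => q _.
  rewrite normrM ler_wpM2l //.
  have [qn|nq] := ltnP q n; last by rewrite wK ?normr0 //; lia.
  have nqn : (n - q.+1 < n)%N by lia.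
  rewrite /s (bigD1 (Ordinal nqn)) //= ler_wpDr ?sumr_ge0 //.
  rewrite le_eqVlt; apply/orP; left; apply/eqP; congr `|w _|; lia.
move=> sCt.
have -> : (C + b * (1 + A * C)) * (t + `|y|) =
  C * t + b * (`|y| + A * (C * t)) + (b * t + C * `|y| + b * A * C * `|y|) by ring.
apply: ler_wpDr; first by rewrite !addr_ge0 ?mulr_ge0.
rewrite lerD // (le_trans wn) // ler_wpM2l // lerD2l ler_wpM2l //.
Qed.

Hypothesis symbol_le1 : forall theta : R, 0 <= theta <= 2 * pi ->
  ComplexField.Normc.normc (symbol r p a_ theta) <= 1.

(** Extending a sequence by zero beyond the ghost cells, the part of its image
    that leaves the domain is lost for the energy but controls the trace. *)
Lemma dirichlet_energy : exists c C : R, [/\ 0 < c, 0 <= C &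
  forall J M w, sqnorm J M (T w) + c * bdry_values r p J w ^+ 2
    <= sqnorm J (M + r) w + C * ghost_values p J w ^+ 2].
Proof.
have [C C0 HC] := outflow_controls_trace (r + p).
set n := (r + p)%N.
pose c := ((C + 1) ^+ 2 * n.+1%:R)^-1.
have C1 : 0 < C + 1 by rewrite ltr_wpDl.
have c0 : 0 < c by rewrite invr_gt0 mulr_gt0 ?exprn_gt0 ?ltr0Sn.
exists c, 1; split=> // J M w.
pose w' j := if j <= J + p%:Z then w j else 0.
have w'0 j : J + p%:Z < j -> w' j = 0 by move=> Jj; rewrite /w' leNgt Jj.
have := energy_cutoff symbol_le1 M w'0.
have -> : sqnorm J M (T w') = sqnorm J M (T w).
  apply: eq_bigr => i _; congr (_ ^+ 2); apply: eq_scheme_step => j ij.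
  by rewrite /w' ifT //; lia.
have -> : sqnorm J (M + r) w' = sqnorm J (M + r) w.
  by apply: eq_bigr => i _; rewrite /w' ifT //; lia.
set t := \sum_(s < p + r) _; set g := \sum_(s < p) _ => h.
have gG : g <= ghost_values p J w ^+ 2.
  apply: le_trans (@sum_sqr_le R p (fun i => `|w (J + p%:Z - i%:Z)|) _) => //.
  apply: ler_sum => i _; rewrite /w' ifT ?real_normK ?num_real //; lia.
have tB : c * bdry_values r p J w ^+ 2 <= t.
  have := HC _ _ w'0; set u := \sum_(i < r + p) `|T w' _|.
  have -> : \sum_(i < r + p) `|w' (J + p%:Z - i%:Z)| = bdry_values r p J w.
    by apply: eq_bigr => i _; rewrite /w' ifT //; lia.
  have u0 : 0 <= u by apply: sumr_ge0.
  have b0 : 0 <= bdry_values r p J w by apply: sumr_ge0.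
  have ut : u ^+ 2 <= n%:R * t.
    rewrite /u (le_trans (sqr_sum_le n (fun i => `|T w' (J + p%:Z + r%:Z - i%:Z)|))) //.
    rewrite ler_wpM2l ?ler0n // /t [(p + r)%N]addnC; apply: ler_sum => i _.
    by rewrite real_normK ?num_real.
  move=> bu; rewrite /c -ler_pdivlMl ?invr_gt0 ?mulr_gt0 ?exprn_gt0 ?ltr0Sn // invrK.
  have t0 : 0 <= t by apply: sumr_ge0 => i _; exact: sqr_ge0.
  rewrite (@le_trans _ _ (((C + 1) * u) ^+ 2)) //.
    rewrite ler_sqr ?nnegrE ?mulr_ge0 ?(ltW C1) // (le_trans bu) //.
    by rewrite ler_wpM2r // lerDl.
  rewrite exprMn -[leRHS]mulrA; apply: ler_wpM2l; rewrite ?sqr_ge0 // (le_trans ut) //.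
  by rewrite ler_wpM2r // ler_nat.
lra.
Qed.

End DirichletLevel.

Section Ramp.
Variables (R : realType) (r p : nat) (a_ : int -> R) (nu : R).
Local Notation T := (scheme_step r p a_).

Hypothesis r_gt0 : (0 < r)%N.
Hypothesis nu_gt0 : 0 < nu.
Hypothesis moment0 : \sum_(l <- stencil r p) a_ l = 1.
Hypothesis moment1 : \sum_(l <- stencil r p) l%:~R * a_ l = - nu.

(** Slope [-1] on the [N] cells that follow the ghost cells. The scheme is exact
    on affine functions, hence its action on a ramp is explicit away from the
    two kinks. *)
Definition ramp (N : nat) (s : int) : int :=
  if s <= p%:Z then N%:Z else if s <= p%:Z + N%:Z then N%:Z + p%:Z - s else 0.

Lemma scheme_step_sub w j :
  T w j - w j = \sum_(l <- stencil r p) a_ l * (w (j + l) - w j).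
Proof.
under eq_bigr do rewrite mulrBr.
by rewrite sumrB -mulr_suml moment0 mul1r.
Qed.

Lemma ramp_linear N (s : int) : p%:Z + r%:Z <= s -> s <= N%:Z ->
  T (fun i => (ramp N i)%:~R) s - (ramp N s)%:~R = nu.
Proof.
move=> ps sN; rewrite scheme_step_sub -[nu]opprK -moment1 -sumrN.
apply: eq_big_seq => l; rewrite mem_stencil => lrp.
rewrite -intrB (_ : ramp N (s + l) - ramp N s = - l) ?rmorphN /=; first by ring.
rewrite /ramp; repeat case: ifP; lia.
Qed.

Lemma ramp_step_bound N (s : int) :
  `|T (fun i => (ramp N i)%:~R) s - (ramp N s)%:~R|
  <= coef_norm r p a_ * (r + p)%:R.
Proof.
rewrite scheme_step_sub (le_trans (ler_norm_sum _ _ _)) // mulr_suml.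
rewrite big_seq [leRHS]big_seq; apply: ler_sum => l; rewrite mem_stencil => lrp.
rewrite normrM ler_wpM2l // -intrB -intr_norm pmulrn ler_int.
rewrite /ramp; repeat case: ifP; lia.
Qed.

Lemma sum_indicator (m lo k : nat) :
  \sum_(i < m) (lo <= i < lo + k)%N%:R <= k%:R :> R.
Proof.
rewrite -natr_sum ler_nat.
suff : (\sum_(i < m) (lo <= i < lo + k) <= minn k (m - lo))%N.
  by move=> /leq_trans; apply; exact: geq_minl.
elim: m => [|m IH]; first by rewrite big_ord0.
rewrite big_ord_recr /=; move: (\sum_(i < m) _)%N IH => x IH.
by case: (boolP (lo <= m < lo + k)%N) => h; rewrite ?h ?(negbTE h) /=; lia.
Qed.

(** A long enough ramp gains energy under the scheme on [s >= 1]: the mean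
    drift [nu] carries [nu N^2] through the top, while the two kinks only cost
    [O(N)]. *)
Lemma ramp_energy_gain : exists2 N, (0 < N)%N & 0 <
  \sum_(s < p + N + r) ((T (fun i => (ramp N i)%:~R) s.+1) ^+ 2
     - (ramp N s.+1)%:~R ^+ 2) :> R.
Proof.
set A := coef_norm r p a_ * (r + p)%:R + nu.
pose k := (p + (p + r))%N.
have A0 : 0 <= A by rewrite addr_ge0 ?mulr_ge0 ?coef_norm_ge0 ?ler0n // ltW.
pose N := (Num.trunc (2 * A * k%:R / nu)).+2.
have hN : 2 * A * k%:R < nu * (N%:R - 1).
  rewrite [ltRHS]mulrC -ltr_pdivrMr //.
  have -> : N%:R - 1 = (Num.trunc (2 * A * k%:R / nu)).+1%:R :> R.
    by rewrite /N -natr1 addrK.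
  exact: truncnS_gt.
have N0 : 0 < N%:R :> R by rewrite ltr0n.
exists N => //; set psi := fun i => (ramp N i)%:~R.
pose ind (lo q : nat) (i : nat) : R := (lo <= i < lo + q)%N%:R.
(* The scheme is compared with the transport by one cell, for which the sum
   telescopes; the indicators [ind] mark the stencils that meet a kink. *)
have step (s : nat) :
  nu * (psi s%:Z ^+ 2 - psi s.+1%:Z ^+ 2) - nu * (psi s%:Z - psi s.+1%:Z)
   - 2 * N%:R * A * (ind 0%N (p + r)%N s + ind N p s)
  <= T psi s.+1%:Z ^+ 2 - psi s.+1%:Z ^+ 2.
  have psiN : 0 <= psi s.+1%:Z <= N%:R.
    by rewrite /psi ler0z [N%:R]pmulrn ler_int /ramp; repeat case: ifP; lia.
  have dpsi : psi s%:Z - psi s.+1%:Z = (ramp N s%:Z - ramp N s.+1%:Z)%:~R.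
    by rewrite intrB.
  have dpsi2 : (psi s%:Z - psi s.+1%:Z) ^+ 2 = psi s%:Z - psi s.+1%:Z.
    rewrite dpsi; have [->|->] : ramp N s%:Z - ramp N s.+1%:Z = 0 \/
       ramp N s%:Z - ramp N s.+1%:Z = 1; rewrite ?expr0n ?expr1n //.
    clear; rewrite /ramp; repeat case: ifP; lia.
  have dpsi01 : 0 <= psi s%:Z - psi s.+1%:Z <= 1.
    by rewrite dpsi ler0z lerz1; clear; rewrite /ramp; repeat case: ifP; lia.
  have [kink|nokink] := boolP ((s < p + r) || (N <= s < N + p))%N.
    have : `|T psi s.+1%:Z - psi s.+1%:Z| <= coef_norm r p a_ * (r + p)%:R.
      exact: ramp_step_bound.
    rewrite ler_norml.
    have i1 : 1 <= ind 0%N (p + r)%N s + ind N p s.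
      case/orP: kink => h; rewrite /ind h ?leq0n ?add0n ?h /=.
        by rewrite lerDl.
      by rewrite lerDr.
    move: (psi s%:Z) (psi s.+1%:Z) (T psi s.+1%:Z) psiN dpsi01 dpsi2 => x y z yN xy xy2 hz.
    have nxy0 : 0 <= nu * (x - y) by rewrite mulr_ge0 ?(ltW nu_gt0); lra.
    have nxy1 : nu * (x - y) <= nu by rewrite ger_pMr //; lra.
    have hA : - A <= z - y - nu * (x - y).
      by move: hz => /andP[hz1 hz2]; rewrite /A; lra.
    have : y * (z - y - nu * (x - y)) >= - (N%:R * A).
      have /andP[yN0 yN1] := yN.
      by have := ler_wpM2l yN0 hA; have := ler_wpM2r A0 yN1; lra.
    have : 2 * N%:R * A * 1 <= 2 * N%:R * A * (ind 0%N (p + r)%N s + ind N p s).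
      by rewrite ler_wpM2l // !mulr_ge0 ?ler0n.
    move: (2 * N%:R * A * (ind 0%N _ _ + _)) => X hX hy.
    have -> : nu * (x ^+ 2 - y ^+ 2) = nu * (x - y) ^+ 2 + 2 * y * (nu * (x - y)) by ring.
    rewrite xy2.
    have hsq : 0 <= (z - y) ^+ 2 by exact: sqr_ge0.
    have -> : z ^+ 2 - y ^+ 2 = (z - y) ^+ 2
      + 2 * (y * (z - y - nu * (x - y))) + 2 * y * (nu * (x - y)) by ring.
    lra.
  have -> : ind 0%N (p + r)%N s = 0.
    rewrite /ind; move: nokink.
    by clear; case: (boolP (0 <= s < 0 + (p + r))%N) => //; lia.
  have -> : ind N p s = 0.
    rewrite /ind; move: nokink.
    by clear; case: (boolP (N <= s < N + p)%N) => //; lia.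
  rewrite addr0 mulr0 subr0.
  have [sN|Ns] := ltnP s N.
    have : T psi s.+1%:Z - psi s.+1%:Z = nu.
      by apply: ramp_linear; clear -nokink sN r_gt0; lia.
    have -> : psi s%:Z = psi s.+1%:Z + 1.
      rewrite /psi -intrD1; congr (_%:~R); clear -nokink sN r_gt0; rewrite /ramp.
      by repeat case: ifP; lia.
    move: (psi _) (T _ _) => y z hz; have -> : z = y + nu by lra.
    have : 0 <= nu ^+ 2 by exact: sqr_ge0.
    have -> : (y + nu) ^+ 2 = y ^+ 2 + 2 * nu * y + nu ^+ 2 by ring.
    have -> : (y + 1) ^+ 2 = y ^+ 2 + 2 * y + 1 by ring.
    lra.
  have ramp0 (i : nat) : (N + p <= i)%N -> psi i%:Z = 0.
    move=> Ni; rewrite /psi (_ : ramp N i = 0) // /ramp.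
    by clear -Ni; repeat case: ifP; lia.
  rewrite !ramp0; try by clear -nokink Ns; lia.
  by rewrite expr0n !subr0 mulr0 subr0 sqr_ge0.
suff : 0 < \sum_(s < p + N + r) (nu * (psi s%:Z ^+ 2 - psi s.+1%:Z ^+ 2)
    - nu * (psi s%:Z - psi s.+1%:Z)
    - 2 * N%:R * A * (ind 0%N (p + r)%N s + ind N p s)).
  by move=> /lt_le_trans; apply; apply: ler_sum => s _; exact: step.
have tele (F : nat -> R) m : \sum_(s < m) (F s - F s.+1) = F 0%N - F m.
  elim: m => [|m IH]; first by rewrite big_ord0 subrr.
  by rewrite big_ord_recr IH /=; ring.
rewrite sumrB sumrB -!mulr_sumr.
rewrite (tele (fun s => psi s%:Z ^+ 2)) (tele (fun s => psi s%:Z)) big_split /=.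
have -> : psi 0%N%:Z = N%:R by rewrite /psi (_ : ramp N _ = N) // /ramp; repeat case: ifP; lia.
have -> : psi (p + N + r)%N%:Z = 0.
  by rewrite /psi (_ : ramp N _ = 0) // /ramp; clear; repeat case: ifP; lia.
rewrite expr0n !subr0.
have s1 := sum_indicator (p + N + r) 0 (p + r).
have s2 := sum_indicator (p + N + r) N p.
have s3 : 2 * N%:R * A * (\sum_(i < p + N + r) ind 0%N (p + r)%N i
   + \sum_(i < p + N + r) ind N p i) <= 2 * N%:R * A * k%:R.
  rewrite ler_wpM2l ?mulr_ge0 ?ler0n // /k natrD addrC; exact: lerD.
have := ltr_pM2l N0 (2 * A * k%:R) (nu * (N%:R - 1)); rewrite hN => s4.
have -> : nu * N%:R ^+ 2 - nu * N%:R = N%:R * (nu * (N%:R - 1)) by ring.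
lra.
Qed.

End Ramp.

Section Stability.
Variables (R : realType) (r p : nat) (a_ : int -> R) (nu : R).
Implicit Types (w e tau : int -> R) (J K : int) (M N kb : nat).

Local Notation T := (scheme_step r p a_).
Local Notation D := (@backward_diff R).

Lemma sum_rev n J (F : int -> R) :
  \sum_(s < n) F (J + n%:Z - s%:Z) = \sum_(s < n) F (J + s.+1%:Z).
Proof.
rewrite (reindex_inj rev_ord_inj); apply: eq_bigr => s _ /=; congr F.
have := ltn_ord s; lia.
Qed.

Lemma oscillation_le n K w (i i' : nat) : (i <= n)%N -> (i' <= n)%N ->
  `|w (K - i%:Z) - w (K - i'%:Z)| <= \sum_(q < n) `|D w (K - q%:Z)|.
Proof.
wlog ii' : i i' / (i <= i')%N => [hw|] ni ni'.
  have [ii'|/ltnW ii'] := leqP i i'; first exact: hw.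
  by rewrite distrC; exact: hw.
rewrite -(subnKC ni') big_split_ord /= ler_wpDr ?sumr_ge0 // => {ni'}.
elim: i' ii' => [|i' IH].
  by rewrite leqn0 => /eqP ->; rewrite subrr normr0 sumr_ge0.
rewrite leq_eqVlt => /orP[/eqP <-|]; first by rewrite subrr normr0 sumr_ge0.
rewrite ltnS => /IH {}IH; rewrite big_ord_recr /=.
have -> : w (K - i%:Z) - w (K - i'.+1%:Z) =
    (w (K - i%:Z) - w (K - i'%:Z)) + D w (K - i'%:Z).
  rewrite /backward_diff (_ : K - i'.+1%:Z = K - i'%:Z - 1); last by lia.
  ring.
by rewrite (le_trans (ler_normD _ _)) // lerD.
Qed.

(** Here [x P] and [x Q] are the ramp after and before one step, [t] and [f]
    the perturbations due to the variation of the sequence at the boundary.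
    Young's inequality moves the cross terms into [eta x^2]. *)
Lemma ler_sqr_perturbation (A x P Q t f delta eta : R) :
  0 < eta -> 0 <= A -> 0 <= delta -> `|P| <= A -> `|Q| <= 1 ->
  `|t| <= A * delta -> `|f| <= delta ->
  x ^+ 2 * (P ^+ 2 - Q ^+ 2) - eta * x ^+ 2
    - ((A ^+ 2 + 1) ^+ 2 / eta + 1) * delta ^+ 2
  <= (x * P + t) ^+ 2 - (x * Q + f) ^+ 2.
Proof.
move=> eta0 A0 d0 PA Q1 tA fd.
have h1 : - (`|x| * (A * (A * delta))) <= x * P * t.
  rewrite lerNl (le_trans (ler_norm _)) // normrN !normrM -mulrA.
  by rewrite ler_wpM2l // ler_pM.
have h2 : x * Q * f <= `|x| * delta.
  rewrite (le_trans (ler_norm _)) // !normrM -mulrA ler_wpM2l //.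
  by rewrite -[delta]mul1r ler_pM.
have h3 : f ^+ 2 <= delta ^+ 2.
  by rewrite -[f ^+ 2]real_normK ?num_real // ler_sqr ?nnegrE.
have h4 : 2 * (`|x| * ((A ^+ 2 + 1) * delta)) <=
    eta * x ^+ 2 + (A ^+ 2 + 1) ^+ 2 / eta * delta ^+ 2.
  rewrite -[x ^+ 2]real_normK ?num_real //.
  move: `|x| => y; rewrite -subr_ge0.
  have -> : eta * y ^+ 2 + (A ^+ 2 + 1) ^+ 2 / eta * delta ^+ 2
     - 2 * (y * ((A ^+ 2 + 1) * delta)) =
    (eta * y - (A ^+ 2 + 1) * delta) ^+ 2 / eta by field; lra.
  by rewrite divr_ge0 ?sqr_ge0 // ltW.
have h5 := sqr_ge0 t.
move: (_ / eta) h4 => q h4.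
have -> : (x * P + t) ^+ 2 - (x * Q + f) ^+ 2 = x ^+ 2 * (P ^+ 2 - Q ^+ 2)
  + 2 * (x * P * t) + t ^+ 2 - 2 * (x * Q * f) - f ^+ 2 by ring.
lra.
Qed.

Hypothesis r_gt0 : (0 < r)%N.
Hypothesis nu_gt0 : 0 < nu.
Hypothesis moment0 : \sum_(l <- stencil r p) a_ l = 1.
Hypothesis moment1 : \sum_(l <- stencil r p) l%:~R * a_ l = - nu.
Hypothesis ar_neq0 : a_ (- r%:Z) != 0.
Hypothesis symbol_le1 : forall theta : R, 0 <= theta <= 2 * pi ->
  ComplexField.Normc.normc (symbol r p a_ theta) <= 1.

Lemma bdry_values_ge0 J w : 0 <= bdry_values r p J w.
Proof. exact: sumr_ge0. Qed.

Lemma bdry_oscillation J w j : J - r%:Z < j <= J + p%:Z ->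
  `|w j - w J| <= bdry_values r p J (D w).
Proof.
move=> jJ; pose i := absz (J + p%:Z - j)%R.
have := @oscillation_le (r + p) (J + p%:Z) w i p.
rewrite (_ : J + p%:Z - i%:Z = j); last by rewrite /i; lia.
by rewrite addrK; apply; rewrite ?/i; lia.
Qed.

(** Extending a sequence to the right by a long ramp starting at its boundary
    value gains a multiple of the square of that value, up to the variation of
    the sequence near the boundary. *)
Lemma neumann_energy : exists c C : R, [/\ 0 < c, 0 <= C &
  forall J M w, sqnorm J M (T w) + c * bdry_values r p J w ^+ 2
    <= sqnorm J (M + r) w + C * bdry_values r p J (D w) ^+ 2].
Proof.
have [N N0 gain] := ramp_energy_gain r_gt0 nu_gt0 moment0 moment1.
have NR : 0 < N%:R :> R by rewrite ltr0n.
pose phi s : R := N%:R^-1 * (ramp p N s)%:~R.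
have phi1 s : s <= p%:Z -> phi s = 1.
  by move=> sp; rewrite /phi /ramp sp mulVf // lt0r_neq0.
have phi0 s : (p + N)%N%:Z < s -> phi s = 0.
  move=> sp; rewrite /phi (_ : ramp p N s = 0) ?mulr0 // /ramp.
  by repeat case: ifP; lia.
have phi_le1 s : `|phi s| <= 1.
  rewrite /phi normrM [X in X * _]ger0_norm ?invr_ge0 ?(ltW NR) //.
  rewrite ler_pdivrMl // mulr1.
  rewrite -intr_norm pmulrn ler_int /ramp; repeat case: ifP; lia.
pose n := (p + N + r)%N.
pose kappa := \sum_(s < n) ((T phi s.+1) ^+ 2 - phi s.+1 ^+ 2).
have kappa0 : 0 < kappa.
  have -> : kappa = N%:R ^- 2 * \sum_(s < n)
      ((T (fun i => (ramp p N i)%:~R) s.+1) ^+ 2 - (ramp p N s.+1)%:~R ^+ 2).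
    rewrite mulr_sumr; apply: eq_bigr => s _.
    by rewrite /phi scheme_stepZ !exprMn -mulrBr exprVn.
  by rewrite mulr_gt0 // invr_gt0 exprn_gt0.
have n0 : (0 < n)%N by rewrite /n; lia.
have nR : 0 < n%:R :> R by rewrite ltr0n.
set A := coef_norm r p a_.
have A0 : 0 <= A by exact: coef_norm_ge0.
pose eta := kappa / (2 * n%:R).
have eta0 : 0 < eta by rewrite divr_gt0 ?mulr_gt0.
pose B := (A ^+ 2 + 1) ^+ 2 / eta + 1.
have B0 : 0 <= B by rewrite addr_ge0 // divr_ge0 ?sqr_ge0 // ltW.
pose m : R := (r + p)%:R.
have m0 : 0 < m by rewrite ltr0n addn_gt0 r_gt0.
exists (kappa / 4 / m ^+ 2), (n%:R * B + kappa / 2); split.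
- by rewrite !divr_gt0 ?exprn_gt0.
- by apply: addr_ge0; [apply: mulr_ge0|apply: divr_ge0]; rewrite ?ler0n // ltW.
move=> J M w; set x := w J; set delta := bdry_values r p J (D w).
have d0 : 0 <= delta by exact: bdry_values_ge0.
pose w' j := if j <= J + p%:Z then w j else x * phi (j - J).
have w'0 j : J + (p + N)%N%:Z < j -> w' j = 0.
  by move=> Jj; rewrite /w' ifF ?phi0 ?mulr0 //; clear -Jj; lia.
have := energy_cutoff symbol_le1 M w'0.
have -> : sqnorm J M (T w') = sqnorm J M (T w).
  apply: eq_bigr => i _; congr (_ ^+ 2); apply: eq_scheme_step => j ij.
  by rewrite /w' ifT //; clear -ij; lia.
have -> : sqnorm J (M + r) w' = sqnorm J (M + r) w.
  by apply: eq_bigr => i _; rewrite /w' ifT //; clear; lia.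
have -> : \sum_(s < p + N + r) T w' (J + (p + N)%N%:Z + r%:Z - s%:Z) ^+ 2 =
    \sum_(s < n) T w' (J + s.+1%:Z) ^+ 2.
  rewrite -(sum_rev n J (fun j => T w' j ^+ 2)); apply: eq_bigr => s _.
  by congr (T w' _ ^+ 2); rewrite /n; clear; lia.
have : \sum_(s < p + N) w' (J + (p + N)%N%:Z - s%:Z) ^+ 2 <=
    \sum_(s < n) w' (J + s.+1%:Z) ^+ 2.
  rewrite (sum_rev _ J (fun j => w' j ^+ 2)) /n [leRHS]big_split_ord /= lerDl.
  by apply: sumr_ge0 => s _; exact: sqr_ge0.
have : kappa / 2 * x ^+ 2 - n%:R * B * delta ^+ 2 <=
    \sum_(s < n) T w' (J + s.+1%:Z) ^+ 2 - \sum_(s < n) w' (J + s.+1%:Z) ^+ 2.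
  pose d j := w' j - x * phi (j - J).
  have dd j : J - r%:Z < j -> `|d j| <= delta.
    move=> Jj; rewrite /d /w'; case: ifP => jJ; last by rewrite subrr normr0.
    by rewrite phi1 ?mulr1 ?bdry_oscillation //; clear -Jj jJ; lia.
  have -> : kappa / 2 * x ^+ 2 - n%:R * B * delta ^+ 2 =
     \sum_(s < n) (x ^+ 2 * (T phi s.+1 ^+ 2 - phi s.+1 ^+ 2) - eta * x ^+ 2
       - B * delta ^+ 2).
    rewrite !sumrB -mulr_sumr -/kappa !sumr_const !card_ord.
    rewrite -[(eta * _) *+ _]mulr_natl -[(B * _) *+ _]mulr_natl.
    have : eta * n%:R = kappa / 2 by rewrite /eta invfM mulrA mulfVK // lt0r_neq0.
    move: (n%:R) (eta) (kappa) (B) (delta) (x) => n1 eta1 kappa1 B1 delta1 x1 h.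
    by rewrite [LHS](_ : _ = kappa1 * x1 ^+ 2
      - kappa1 / 2 * x1 ^+ 2 - n1 * B1 * delta1 ^+ 2); [rewrite -h|]; field.
  rewrite -sumrB; apply: ler_sum => s _.
  have -> : w' (J + s.+1%:Z) = x * phi s.+1 + d (J + s.+1%:Z).
    by rewrite /d [J + _ - J]addrAC subrr add0r; ring.
  have -> : T w' (J + s.+1%:Z) = x * T phi s.+1 + T d (J + s.+1%:Z).
    rewrite -scheme_stepZ -big_split; apply: eq_bigr => l _ /=.
    rewrite /d -mulrDr; congr (_ * _).
    by rewrite [J + _ + l - J](_ : _ = s.+1%:Z + l); [ring|clear; lia].
  apply: (@ler_sqr_perturbation A) => //.
  - by rewrite -[leRHS]mulr1; apply: scheme_step_bound => i _; exact: phi_le1.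
  - by apply: scheme_step_bound => i hi; apply: dd; clear -hi; lia.
  - by apply: dd; clear; lia.
have : bdry_values r p J w ^+ 2 / m ^+ 2 <= 2 * x ^+ 2 + 2 * delta ^+ 2.
  have bm : bdry_values r p J w <= m * (`|x| + delta).
    rewrite /bdry_values /m mulr_natl -[(r + p)%N in leRHS]card_ord -sumr_const.
    apply: ler_sum => i _.
    have := @bdry_oscillation J w (J + p%:Z - i%:Z) _; rewrite -/delta -/x => hb.
    rewrite -[w _](subrK x) addrC (le_trans (ler_normD _ _)) // lerD2l hb //.
    have := ltn_ord i; clear; lia.
  rewrite ler_pdivrMr ?exprn_gt0 //.
  rewrite (@le_trans _ _ ((m * (`|x| + delta)) ^+ 2)) //.
    rewrite ler_sqr ?nnegrE ?bdry_values_ge0 //.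
    by rewrite mulr_ge0 ?addr_ge0 ?(ltW m0).
  rewrite exprMn mulrC ler_wpM2r ?sqr_ge0 // -[x ^+ 2]real_normK ?num_real //.
  by have := sqr_ge0 (`|x| - delta); lra.
move: (sqnorm _ _ _) (sqnorm _ _ _) (\sum_(s < n) _) (\sum_(s < n) _) => E E' S S'.
set q := bdry_values r p J w ^+ 2; rewrite -[_ / m ^+ 2 * q]mulrAC -[_ * q / _]mulrA.
move: (q / _) => Q hQ.
have : kappa / 4 * Q <= kappa / 4 * (2 * x ^+ 2 + 2 * delta ^+ 2).
  by rewrite ler_wpM2l // divr_ge0 // ltW.
lra.
Qed.

(** The backward differences of a solution solve the same scheme with a
    boundary condition of lower order. Starting from the Dirichlet condition
    for [D^kb e], each level absorbs the boundary terms of the previous one. *)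
Lemma energy_estimate kb : exists (g : nat -> R) (c C : R),
  [/\ g 0%N = 1, forall m, 0 <= g m, 0 < c, 0 <= C & forall J M e,
  \sum_(m < kb.+1) g m * sqnorm J M (T (iter m D e)) + c * bdry_values r p J e ^+ 2
  <= \sum_(m < kb.+1) g m * sqnorm J (M + r) (iter m D e)
     + C * ghost_values p J (iter kb D e) ^+ 2].
Proof.
elim: kb => [|kb [g [c [C [g0 gge0 c0 C0 IH]]]]].
  have [c [C [c0 C0 H]]] := dirichlet_energy ar_neq0 symbol_le1.
  exists (fun=> 1), c, C; split=> // J M e.
  by rewrite !big_ord_recl !big_ord0 /= !mul1r !addr0.
have [c' [C' [c'0 C'0 H]]] := neumann_energy.
(* The trace term of the lower levels, weighted by [lam], absorbs the
   boundary term of the new one. *)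
pose lam := C' / c.
have lam0 : 0 <= lam by rewrite divr_ge0 // ltW.
exists (fun m => if m is m'.+1 then lam * g m' else 1), c', (lam * C).
split=> //; [by case=> // m; rewrite mulr_ge0|by rewrite mulr_ge0|].
move=> J M e; rewrite (big_ord_recl kb.+1) [in leRHS](big_ord_recl kb.+1) /= !mul1r.
have := H J M e; have := ler_wpM2l lam0 (IH J M (D e)).
under [in X in _ -> _ -> X]eq_bigr do rewrite -iterS iterSr -mulrA.
under [in X in _ -> _ -> _ <= X]eq_bigr do rewrite -iterS iterSr -mulrA.
rewrite -!mulr_sumr.
rewrite -iterSr mulrDr [leRHS]mulrDr mulrA [lam * c]divfK ?lt0r_neq0 //=.
rewrite mulrA.
lra.
Qed.

End Stability.

(** * Stability with sources *)

Section Accumulation.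
Variables (R : realType) (r p : nat) (a_ : int -> R) (nu : R).
Implicit Types (w tau : int -> R) (J K : int) (M N kb : nat).

Local Notation T := (scheme_step r p a_).
Local Notation D := (@backward_diff R).

Lemma sqnorm_ge0 J M w : 0 <= sqnorm J M w.
Proof. by apply: sumr_ge0 => i _; exact: sqr_ge0. Qed.

Lemma eq_sqnorm J M w w' : (forall j, j <= J -> w j = w' j) ->
  sqnorm J M w = sqnorm J M w'.
Proof. by move=> ww'; apply: eq_bigr => i _; rewrite ww' //; lia. Qed.

Lemma sqr_add_le (x y d : R) : 0 < d ->
  (x + y) ^+ 2 <= (1 + d) * x ^+ 2 + (1 + d^-1) * y ^+ 2.
Proof.
move=> d0; rewrite -subr_ge0.
have -> : (1 + d) * x ^+ 2 + (1 + d^-1) * y ^+ 2 - (x + y) ^+ 2 =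
  (d * x - y) ^+ 2 / d by field; lra.
by rewrite divr_ge0 ?sqr_ge0 // ltW.
Qed.

Lemma sqnorm_add_le J M w w' (d : R) : 0 < d ->
  sqnorm J M (fun j => w j + w' j)
  <= (1 + d) * sqnorm J M w + (1 + d^-1) * sqnorm J M w'.
Proof.
move=> d0; rewrite !mulr_sumr -big_split; apply: ler_sum => i _.
exact: sqr_add_le.
Qed.

(** Differences commute with the scheme; the equation at [j <= J] only involves
    the equations of the cells on its left. *)
Lemma iter_diff_step m J w w' tau :
  (forall j, j <= J -> w' j = T w j + tau j) ->
  forall j, j <= J -> iter m D w' j = T (iter m D w) j + iter m D tau j.
Proof.
move=> ww'; elim: m => [|m IH] j jJ; first exact: ww'.
rewrite /= {1}/backward_diff !IH //; last by lia.
rewrite /backward_diff /scheme_step opprD addrACA -sumrB; congr (_ + _).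
by apply: eq_bigr => l _; rewrite mulrBr addrAC.
Qed.

Lemma sqnorm_iter_diff m J w (S : R) : (forall M, sqnorm J M w <= S) ->
  forall M, sqnorm J M (iter m D w) <= 4 ^+ m * S.
Proof.
move=> wS; elim: m => [|m IH] M; first by rewrite mul1r.
set v := iter m D w in IH *; rewrite /= -/v exprS -mulrA.
have -> : 4 * (4 ^+ m * S) = 2 * (4 ^+ m * S) + 2 * (4 ^+ m * S) by ring.
have h : sqnorm J M (D v) <= 2 * sqnorm J M v + 2 * sqnorm J M.+1 v.
  rewrite {3}/sqnorm big_ord_recl mulrDr addrCA.
  apply: ler_wpDl; first by rewrite pmulr_rge0 ?sqr_ge0.
  rewrite /sqnorm !mulr_sumr -big_split; apply: ler_sum => i _ /=.
  rewrite /backward_diff (_ : J - (bump 0 i)%:Z = J - i%:Z - 1); last first.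
    by rewrite /bump; lia.
  by move: (v _) (v _) => x y; have := sqr_ge0 (x + y); lra.
by rewrite (le_trans h) // lerD // ler_wpM2l.
Qed.

Hypothesis r_gt0 : (0 < r)%N.
Hypothesis nu_gt0 : 0 < nu.
Hypothesis moment0 : \sum_(l <- stencil r p) a_ l = 1.
Hypothesis moment1 : \sum_(l <- stencil r p) l%:~R * a_ l = - nu.
Hypothesis ar_neq0 : a_ (- r%:Z) != 0.
Hypothesis symbol_le1 : forall theta : R, 0 <= theta <= 2 * pi ->
  ComplexField.Normc.normc (symbol r p a_ theta) <= 1.

(** Boundary data accumulate like their square sum and interior sources like
    the square of their sum. This is where the two contributions [sqrt T] and
    [T] of the error bound separate. *)
Lemma stability kb : exists2 C : R, 0 <= C &
  forall J N (e tau : nat -> int -> R) (G S : R),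
  0 <= S -> 0 <= G ->
  (forall j, j <= J -> e 0%N j = 0) ->
  (forall n, (n < N)%N -> forall j, j <= J -> e n.+1 j = T (e n) j + tau n j) ->
  (forall n, (n < N)%N -> ghost_values p J (iter kb D (e n)) <= G) ->
  (forall n, (n < N)%N -> forall M, sqnorm J M (tau n) <= S) ->
  forall n, (n <= N)%N -> forall M,
  sqnorm J M (e n) <= C * (N%:R * G ^+ 2 + N%:R ^+ 2 * S).
Proof.
have [g [c [C [g0 gge0 c0 C0 H]]]] :=
  energy_estimate r_gt0 nu_gt0 moment0 moment1 ar_neq0 symbol_le1 kb.
pose gam := \sum_(m < kb.+1) g m * 4 ^+ m.
have gam0 : 0 <= gam by apply: sumr_ge0 => m _; rewrite mulr_ge0 // exprn_ge0.
exists (expR 1 * (2 * (C + gam))).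
  by rewrite mulr_ge0 ?expR_ge0 // mulr_ge0 // addr_ge0.
move=> J N e tau G S S0 G0 e0 estep eG tauS n nN M.
pose Y n M := \sum_(m < kb.+1) g m * sqnorm J M (iter m D (e n)).
have eY : sqnorm J M (e n) <= Y n M.
  rewrite /Y big_ord_recl g0 mul1r lerDl.
  by apply: sumr_ge0 => m _; rewrite mulr_ge0 ?sqnorm_ge0.
apply: le_trans eY _.
have Y0 M' : Y 0%N M' = 0.
  apply: big1 => m _; rewrite [X in _ * X](_ : _ = 0) ?mulr0 //.
  apply: big1 => i _; rewrite (_ : iter m D (e 0%N) _ = 0) ?expr0n //.
  have : J - i%:Z <= J by lia.
  move: (J - _) => j; elim: (m : nat) j => [|m' IH] j jJ /=; first exact: e0.
  by rewrite /backward_diff !IH ?subrr //; lia.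
have [N0|N0] := posnP N.
  by rewrite (_ : n = 0%N) ?Y0 ?N0 ?expr0n ?mul0r ?addr0 ?mulr0 //; lia.
have NR : 0 < N%:R :> R by rewrite ltr0n.
(* With this parameter in Young's inequality the amplification over [N] steps
   stays below [(1 + 1/N)^N <= e]. *)
pose d : R := N%:R^-1.
have d0 : 0 < d by rewrite invr_gt0.
pose X := (1 + d) * (C * G ^+ 2) + (1 + N%:R) * (gam * S).
have X0 : 0 <= X.
  have ? := ltW d0; have ? := ltW NR.
  by rewrite addr_ge0 // !mulr_ge0 // ?addr_ge0 // sqr_ge0.
have Ystep k M' : (k < N)%N -> Y k.+1 M' <= (1 + d) * Y k (M' + r)%N + X.
  move=> kN.
  have : Y k.+1 M' <= (1 + d) * (\sum_(m < kb.+1) g m * sqnorm J M' (T (iter m D (e k))))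
      + (1 + N%:R) * (gam * S).
    rewrite !mulr_sumr mulr_suml mulr_sumr -big_split; apply: ler_sum => m _ /=.
    rewrite (@eq_sqnorm J M' _
      (fun j => T (iter m D (e k)) j + iter m D (tau k) j)); last first.
      exact: iter_diff_step (estep k kN).
    rewrite [(1 + d) * _]mulrCA -[g m * 4 ^+ m * S]mulrA [(1 + N%:R) * _]mulrCA -mulrDr.
    rewrite ler_wpM2l // (le_trans (sqnorm_add_le _ _ _ _ d0)) // lerD2l.
    rewrite invrK ler_wpM2l ?addr_ge0 ?ler0n //.
    exact: (sqnorm_iter_diff _ (tauS k kN)).
  have h1 : \sum_(m < kb.+1) g m * sqnorm J M' (T (iter m D (e k))) <=
      Y k (M' + r)%N + C * G ^+ 2.
    have := H J M' (e k).
    have : 0 <= c * bdry_values r p J (e k) ^+ 2 by rewrite mulr_ge0 ?sqr_ge0 // ltW.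
    have : C * ghost_values p J (iter kb D (e k)) ^+ 2 <= C * G ^+ 2.
      rewrite ler_wpM2l // ler_sqr ?nnegrE ?eG //.
      exact: sumr_ge0.
    rewrite -/(Y k (M' + r)%N); lra.
  have := ler_wpM2l (_ : 0 <= 1 + d) h1; rewrite ?addr_ge0 ?(ltW d0) // => /(_ isT).
  by rewrite /X; lra.
have Ybound k M' : (k <= N)%N -> Y k M' <= (1 + d) ^+ k * (k%:R * X).
  elim: k M' => [|k IH] M' kN; first by rewrite Y0 mul0r mulr0.
  rewrite (le_trans (Ystep k M' kN)) //.
  have := IH (M' + r)%N (ltnW kN).
  rewrite -natr1 exprS.
  have : 1 <= (1 + d) ^+ k.+1 by rewrite exprn_ege1 // lerDl ltW.
  rewrite exprS; set z := (1 + d) ^+ k => hz hY.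
  have := ler_wpM2l (_ : 0 <= 1 + d) hY; rewrite ?addr_ge0 ?(ltW d0) // => /(_ isT).
  have := ler_wpM2r X0 hz.
  lra.
rewrite (le_trans (Ybound n M nN)) //.
have h1 : (1 + d) ^+ n <= expR 1.
  rewrite (@le_trans _ _ (expR d ^+ N)) //.
    rewrite (@le_trans _ _ ((1 + d) ^+ N)) //.
      by rewrite ler_weXn2l // lerDl ltW.
    by rewrite lerXn2r ?nnegrE ?expR_ge0 ?expR_ge1Dx // addr_ge0 // ltW.
  by rewrite -expRM_natl mulfV ?lt0r_neq0.
have h2 : n%:R * X <= 2 * (C + gam) * (N%:R * G ^+ 2 + N%:R ^+ 2 * S).
  have hX : X <= 2 * (C * G ^+ 2) + 2 * N%:R * (gam * S).
    have N1 : 1 <= N%:R :> R by rewrite ler1n.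
    have d1 : d <= 1 by rewrite invf_le1.
    rewrite /X lerD // ler_wpM2r ?mulr_ge0 ?sqr_ge0 //; lra.
  rewrite (@le_trans _ _ (N%:R * X)) ?ler_wpM2r ?ler_nat //.
  have := ler_wpM2l (ltW NR) hX.
  have : 0 <= C * (N%:R ^+ 2 * S) by rewrite !mulr_ge0 // ltW.
  have : 0 <= gam * (N%:R * G ^+ 2) by rewrite !mulr_ge0 ?sqr_ge0 // ltW.
  lra.
rewrite -mulrA; apply: ler_pM => //.
- by rewrite exprn_ge0 // addr_ge0 // ltW.
- by rewrite mulr_ge0 ?ler0n.
Qed.

End Accumulation.

(** * Smooth plateaus *)

Section SmoothFunctions.
Variable R : realType.
Implicit Types (f g : R -> R) (x : R) (q : {poly R}).

Lemma is_derive_of_modulus f x (l : R) :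
  (forall e : R, 0 < e -> exists2 d : R, 0 < d &
     forall h, `|h| < d -> `|f (x + h) - f x - h * l| <= e * `|h|) ->
  is_derive x 1 f l.
Proof.
move=> H.
have cvgf : h^-1 *: (f (h + x) - f x) @[h --> 0^'] --> l.
  apply/cvgrPdist_le => e e0; have [d d0 Hd] := H e e0.
  near=> h.
  have h0 : h != 0 by near: h; exact: nbhs_dnbhs_neq.
  have hd : `|h| < d.
    near: h; apply: dnbhs0_lt; exact: d0.
  rewrite distrC (_ : _ *: _ - l = h^-1 * (f (x + h) - f x - h * l)); last first.
    by rewrite /GRing.scale /= [h + x]addrC; field.
  by rewrite normrM normfV mulrC ler_pdivrMr ?normr_gt0 // Hd.
apply: DeriveDef.
  apply/cvg_ex; exists l => /=.
  by under eq_fun do rewrite [_ *: 1]mulr1.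
rewrite /derive.
under eq_fun do rewrite [_ *: 1]mulr1.
exact: cvg_lim cvgf.
Unshelve. all: by end_near. Qed.

Definition smooth f := forall n x, derivable (f^`(n)%classic) x 1.

(** Smoothness by coinduction: it suffices to exhibit a class of derivable
    functions that is stable under derivation. *)
Lemma smooth_coind (P : (R -> R) -> Prop) :
  (forall f, P f -> exists2 f', P f' & forall x, is_derive x 1 f (f' x)) ->
  forall f, P f -> smooth f.
Proof.
move=> HP f Pf n x.
have : P (f^`(n)%classic).
  elim: n => [|n IH] //; rewrite derive1nS.
  have [f' Pf' ff'] := HP _ IH.
  suff -> : derive1 (f^`(n)%classic) = f' by [].
  by apply/funext => y; rewrite derive1E; have := ff' y => d; rewrite derive_val.
by move=> /HP [f' _ /(_ x) []].
Qed.

Lemma smooth_derive f : smooth f ->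
  smooth (derive1 f) /\ forall x, is_derive x 1 f (derive1 f x).
Proof.
move=> sf; split=> [n x|x].
  by have := sf n.+1 x; rewrite /derive1n iterSr.
apply: DeriveDef; first exact: (sf 0%N x).
by rewrite derive1E.
Qed.

Lemma smooth_primitive f F : smooth f -> (forall x, is_derive x 1 F (f x)) ->
  smooth F.
Proof.
move=> sf Ff.
apply: (@smooth_coind (fun g => smooth g \/ g = F)); last by right.
move=> g [sg|->]; last by exists f => //; left.
by have [? ?] := smooth_derive sg; exists (derive1 g) => //; left.
Qed.

Lemma smoothB f g : smooth f -> smooth g -> smooth (fun x => f x - g x).
Proof.
move=> sf sg.
apply: (@smooth_coind (fun u => exists f g, [/\ smooth f, smooth g & u = fun x => f x - g x])).
  move=> _ [u [v [su sv ->]]].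
  have [su' du] := smooth_derive su; have [sv' dv] := smooth_derive sv.
  exists (fun x => derive1 u x - derive1 v x); first by exists (derive1 u), (derive1 v).
  by move=> x; apply: is_deriveB.
by exists f, g.
Qed.

Lemma smooth_affine f (a b : R) : smooth f -> smooth (fun x => f (a * x + b)).
Proof.
move=> sf.
apply: (@smooth_coind (fun u => exists c f, smooth f /\ u = fun x => c * f (a * x + b))).
  move=> _ [c [u [su ->]]]; have [su' du] := smooth_derive su.
  exists (fun x => c * a * derive1 u (a * x + b)); first by exists (c * a), (derive1 u).
  move=> x.
  have d1 : is_derive x 1 (fun x => a * x + b) a.
    apply: is_derive_eq; rewrite /GRing.scale /=; ring.
  have d2 := @is_derive1_comp R u (fun x => a * x + b) x _ _ (du _) d1.
  apply: (@is_derive_eq _ _ _ (fun x => c * u (a * x + b))).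
  rewrite /GRing.scale /=; ring.
by exists 1, f; split=> //; apply/funext => x; rewrite mul1r.
Qed.

(** Products are not stable under derivation, but their sums are. *)
Inductive product_span : (R -> R) -> Prop :=
| product_span_mul u v : smooth u -> smooth v ->
    product_span (fun x => u x * v x)
| product_span_add u v : product_span u -> product_span v ->
    product_span (fun x => u x + v x).

Lemma smoothM f g : smooth f -> smooth g -> smooth (fun x => f x * g x).
Proof.
move=> sf sg; apply: (@smooth_coind product_span); last exact: product_span_mul.
move=> u; elim=> {u} [u v su sv|u v _ [u' Pu' uu'] _ [v' Pv' vv']].
  have [su' du] := smooth_derive su; have [sv' dv] := smooth_derive sv.
  exists (fun x => u x * derive1 v x + derive1 u x * v x).
    by apply: product_span_add; apply: product_span_mul.
  move=> x; have := is_deriveM (du x) (dv x).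
  by rewrite /GRing.scale /= [v x * _]mulrC.
exists (fun x => u' x + v' x); first exact: product_span_add.
by move=> x; exact: is_deriveD.
Qed.

(** The class of the derivatives of [exp(-1/x)], extended by zero. *)
Definition flat_exp q x : R := if 0 < x then q.[x^-1] * expR (- x^-1) else 0.

Lemma expR_ge_pow (y : R) n : 0 <= y -> y ^+ n <= n`!%:R * expR y.
Proof.
move=> y0; case: n => [|n].
  by rewrite expr0 mul1r (le_trans _ (expR_ge1Dx y)) // lerDl.
have n0 : 0 < (n.+1)`!%:R :> R by rewrite ltr0n fact_gt0.
rewrite -ler_pdivrMl // mulrC (le_trans _ (expR_ge1Dxn n y0)) //.
by rewrite lerDr.
Qed.

(** The exponential beats every power of [1/x]; the quadratic bound is what
    derivability at the origin requires. *)
Lemma flat_exp_bound q : exists2 C : R, 0 < C &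
  forall x, 0 < x -> x <= 1 -> `|flat_exp q x| <= C * x ^+ 2.
Proof.
pose n := (size q).+2.
pose B := \sum_(i < size q) `|q`_i|.
have B0 : 0 <= B by apply: sumr_ge0.
exists (B * n`!%:R + 1); first by rewrite ltr_wpDl // mulr_ge0.
move=> x x0 x1; rewrite /flat_exp x0 normrM [`|expR _|]ger0_norm ?expR_ge0 //.
set y := x^-1; have y0 : 0 < y by rewrite invr_gt0.
have y1 : 1 <= y by rewrite invf_ge1.
have qB : `|q.[y]| <= B * y ^+ (size q).
  rewrite horner_coef mulr_suml (le_trans (ler_norm_sum _ _ _)) //.
  apply: ler_sum => i _; rewrite normrM ler_wpM2l //.
  rewrite normrX ger0_norm ?(ltW y0) // ler_weXn2l //; exact: ltnW.
have eB : y ^+ size q * expR (- y) <= n`!%:R * x ^+ 2.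
  rewrite expRN ler_pdivrMr ?expR_gt0 // mulrAC.
  have := expR_ge_pow n (ltW y0); rewrite /n -addn2 exprD => h.
  rewrite -ler_pdivrMr ?exprn_gt0 // (le_trans _ h) //.
  by rewrite ler_wpM2l ?exprn_ge0 ?(ltW y0) // /y exprVn.
rewrite (le_trans (ler_wpM2r (expR_ge0 _) qB)) // -mulrA.
rewrite (le_trans (ler_wpM2l B0 eB)) // mulrA ler_wpM2r ?sqr_ge0 // lerDl //.
Qed.

Lemma is_derive_flat_exp q x :
  is_derive x 1 (flat_exp q) (flat_exp ('X ^+ 2 * (q - q^`())) x).
Proof.
have [x0|x0|->] := ltgtP x 0.
- rewrite [X in is_derive _ _ _ X]/flat_exp ltNge (ltW x0) /=.
  apply: (@near_eq_is_derive _ _ _ (cst 0)).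
  near=> y; rewrite /flat_exp ifF //; apply/negbTE; rewrite -leNgt.
  by near: y; exact: lt_le_nbhsl.
- rewrite [X in is_derive _ _ _ X]/flat_exp x0.
  have dV : is_derive x 1 (fun y : R => y^-1) (- x ^- 2).
    have := @is_deriveV R id x 1 1 (lt0r_neq0 x0) (is_derive_id _ _).
    by rewrite /GRing.scale /= mulr1.
  have d1 := @is_derive1_comp R (horner q) (fun y => y^-1) x _ _ (is_derive_poly _ _) dV.
  have dN : is_derive x 1 (fun y : R => - y^-1) (x ^- 2).
    by have := is_deriveN dV; rewrite opprK.
  have d2 := @is_derive1_comp R expR (fun y => - y^-1) x _ _ (is_derive_expR _) dN.
  have d12 := is_deriveM d1 d2.
  have near_x : \near x, (fun y => q.[y^-1] * expR (- y^-1)) x = flat_exp q x.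
    by near=> y; rewrite /flat_exp ifT //; near: y; exact: lt_nbhsr.
  have d3 := near_eq_is_derive near_x d12.
  apply: is_derive_eq.
  rewrite /GRing.scale /= !hornerE /= exprVn; ring.
- rewrite [X in is_derive _ _ _ X]/flat_exp ltxx; apply: is_derive_of_modulus => e e0.
  have [C C0 HC] := flat_exp_bound q.
  exists (Num.min 1 (e / C)); first by rewrite lt_min ltr01 divr_gt0.
  move=> h; rewrite lt_min => /andP[h1 he].
  rewrite add0r mulr0 subr0 [flat_exp q 0]/flat_exp ltxx subr0.
  have [h0|h0] := ltP 0 h; last by rewrite /flat_exp ltNge h0 /= normr0 mulr_ge0 // ltW.
  move: h1 he; rewrite gtr0_norm // => h1 he.
  rewrite (le_trans (HC _ h0 (ltW h1))) // expr2 mulrA ler_wpM2r ?(ltW h0) //.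
  by rewrite mulrC -ler_pdivlMr // ltW.
Unshelve. all: by end_near. Qed.

Lemma smooth_flat_exp q : smooth (flat_exp q).
Proof.
apply: (@smooth_coind (fun f => exists q, f = flat_exp q)); last by exists q.
move=> _ [u ->]; exists (flat_exp ('X ^+ 2 * (u - u^`()))); first by eexists.
exact: is_derive_flat_exp.
Qed.

(** A smooth approximation of the indicator function of [(c, d)]. *)
Definition plateau (c d eps x : R) : R :=
  flat_exp 1 (eps^-1 * (x - c)) * flat_exp 1 (eps^-1 * (d - x)).

Lemma flat_exp1_ge0 x : 0 <= flat_exp 1 x.
Proof. by rewrite /flat_exp; case: ifP => // _; rewrite hornerC mul1r expR_ge0. Qed.

Lemma flat_exp1_le1 x : flat_exp 1 x <= 1.
Proof.
rewrite /flat_exp; case: ifP => // x0; rewrite hornerC mul1r -expR0 ler_expR.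
by rewrite oppr_le0 invr_ge0 ltW.
Qed.

Lemma plateau_ge0 c d eps x : 0 <= plateau c d eps x.
Proof. by rewrite mulr_ge0 ?flat_exp1_ge0. Qed.

Lemma plateau_le1 c d eps x : plateau c d eps x <= 1.
Proof. by rewrite mulr_ile1 ?flat_exp1_ge0 ?flat_exp1_le1. Qed.

Lemma plateau_eq0 c d eps x : 0 < eps -> (x <= c) || (d <= x) -> plateau c d eps x = 0.
Proof.
move=> e0 /orP[xc|dx]; rewrite /plateau /flat_exp.
  by rewrite ifF ?mul0r // pmulr_rgt0 ?invr_gt0 // subr_gt0 ltNge xc.
by rewrite [X in _ * X]ifF ?mulr0 // pmulr_rgt0 ?invr_gt0 // subr_gt0 ltNge dx.
Qed.

Lemma smooth_plateau c d eps : smooth (plateau c d eps).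
Proof.
apply: smoothM.
  have -> : (fun x => flat_exp 1 (eps^-1 * (x - c))) =
     (fun x => flat_exp 1 (eps^-1 * x + - (eps^-1 * c))).
    by apply/funext => x; rewrite mulrBr.
  exact/smooth_affine/smooth_flat_exp.
have -> : (fun x => flat_exp 1 (eps^-1 * (d - x))) =
     (fun x => flat_exp 1 (- eps^-1 * x + eps^-1 * d)).
  by apply/funext => x; congr flat_exp; ring.
exact/smooth_affine/smooth_flat_exp.
Qed.

Lemma cvg_flat_exp1 (y : R) : 0 < y ->
  flat_exp 1 ((n.+1%:R^-1 : R)^-1 * y) @[n --> \oo] --> (1 : R).
Proof.
move=> y0.
have -> : (fun n : nat => flat_exp 1 ((n.+1%:R^-1 : R)^-1 * y)) =
    (fun n : nat => expR (- (n.+1%:R^-1 * y^-1))).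
  apply/funext => n; rewrite /flat_exp invrK mulr_gt0 ?ltr0Sn // hornerC mul1r.
  by rewrite invfM.
have h : (fun n : nat => - (n.+1%:R^-1 * y^-1)) @ \oo --> (0 : R).
  rewrite -oppr0 -(mul0r y^-1); apply: cvgN; apply: cvgMl; exact: cvg_harmonic.
by rewrite -[X in _ --> X]expR0; exact: (cvg_comp _ _ h (@continuous_expR R 0)).
Qed.

Lemma cvg_plateau c d x : plateau c d (n.+1%:R^-1) x @[n --> \oo] -->
  (\1_(`]c, d[%classic) x : R).
Proof.
have [/andP[cx xd]|nx] := boolP (c < x < d).
  rewrite indicE mem_set /= ?in_itv /= ?cx ?xd //.
  have xc0 : 0 < x - c by rewrite subr_gt0.
  have dx0 : 0 < d - x by rewrite subr_gt0.
  have h := cvgM (cvg_flat_exp1 xc0) (cvg_flat_exp1 dx0).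
  rewrite [X in _ --> X]mulr1 in h; exact: h.
rewrite indicE memNset /= ?in_itv /=; last exact/negP.
apply: cvg_near_cst; apply: nearW => n; apply: plateau_eq0.
  by rewrite invr_gt0 ltr0Sn.
by rewrite !leNgt -negb_and.
Qed.

End SmoothFunctions.

(** * Integrals over intervals *)

Section IntervalIntegral.
Variable R : realType.
Implicit Types (f g u : R -> R) (x y z c d h : R).
Notation mu := (@lebesgue_measure R).

Definition interval_integrable f := forall x y, mu.-integrable `]x, y] (EFin \o f).

Definition integral_on f x y : R := \int[mu]_(t in `]x, y]) f t.

Lemma interval_integrable_cst (k : R) : interval_integrable (cst k).
Proof.
move=> x y.
have h : mu.-integrable `[x, y] (EFin \o cst k).
  apply: continuous_compact_integrable; first exact: segment_compact.
  by apply: continuous_subspaceT => ?; exact: cvg_cst.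
apply: integrableS h => //; exact: subset_itv_oc_cc.
Qed.

Lemma interval_integrable_le f g : measurable_fun setT f ->
  (forall t, `|f t| <= `|g t|) -> interval_integrable g -> interval_integrable f.
Proof.
move=> mf fg ig x y; apply: (le_integrable _ _ _ (ig x y)) => //.
  by apply/measurable_EFinP; exact: measurable_funS mf.
by move=> t _; rewrite /= lee_fin.
Qed.

Lemma interval_integrable_norm f : interval_integrable f ->
  interval_integrable (fun t => `|f t|).
Proof. by move=> fi x y; have := integrable_norm (fi x y). Qed.

Lemma interval_integrableZ f (k : R) : interval_integrable f ->
  interval_integrable (fun t => k * f t).
Proof. by move=> fi x y; apply: (integrableZl _ k (fi x y)). Qed.

Lemma interval_integrableD f g : interval_integrable f -> interval_integrable g ->
  interval_integrable (fun t => f t + g t).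
Proof. by move=> fi gi x y; apply: (integrableD _ (fi x y) (gi x y)). Qed.

Lemma interval_integrableM f g (B : R) : measurable_fun setT f ->
  interval_integrable f ->
  measurable_fun setT g -> (forall t, `|g t| <= B) ->
  interval_integrable (fun t => f t * g t).
Proof.
move=> mf fi mg gB.
apply: (@interval_integrable_le _ (fun t => B * f t)).
- exact: measurable_funM.
- by move=> t; rewrite !normrM mulrC ler_wpM2r // (le_trans (gB t)) // ler_norm.
- exact: interval_integrableZ.
Qed.

Lemma integral_on_chasles f x y z : interval_integrable f -> x <= y -> y <= z ->
  integral_on f x z = integral_on f x y + integral_on f y z.
Proof.
move=> fi xy yz; have := @Rintegral_itvB R f (BRight x) (BRight z) y (fi x z).
by rewrite !bnd_simp /integral_on => /(_ xy yz) <-; rewrite addrC subrK.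
Qed.

Lemma integral_on_ge0 f x y : (forall t, 0 <= f t) -> 0 <= integral_on f x y.
Proof. by move=> f0; apply: Rintegral_ge0. Qed.

Lemma integral_on_le f g x y : interval_integrable f -> interval_integrable g ->
  (forall t, x < t <= y -> f t <= g t) -> integral_on f x y <= integral_on g x y.
Proof.
by move=> fi gi fg; apply: (le_Rintegral _ (fi x y) (gi x y)).
Qed.

Lemma eq_integral_on f g x y :
  (forall t, x < t <= y -> f t = g t) -> integral_on f x y = integral_on g x y.
Proof. by move=> fg; apply: eq_Rintegral => t; rewrite inE /= in_itv /= => /fg. Qed.

Lemma norm_integral_on_le f x y : interval_integrable f ->
  `|integral_on f x y| <= integral_on (fun t => `|f t|) x y.
Proof. by move=> fi; apply: (le_normr_Rintegral _ (fi x y)). Qed.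

Lemma integral_onZ f (k : R) x y : interval_integrable f ->
  integral_on (fun t => k * f t) x y = k * integral_on f x y.
Proof. by move=> fi; apply: (RintegralZl _ _ (fi x y)). Qed.

Lemma integral_onD f g x y : interval_integrable f -> interval_integrable g ->
  integral_on (fun t => f t + g t) x y = integral_on f x y + integral_on g x y.
Proof. by move=> fi gi; apply: (RintegralD _ (fi x y) (gi x y)). Qed.

Lemma integral_onB f g x y : interval_integrable f -> interval_integrable g ->
  integral_on (fun t => f t - g t) x y = integral_on f x y - integral_on g x y.
Proof. by move=> fi gi; apply: (RintegralB _ (fi x y) (gi x y)). Qed.

Lemma integral_on_cst (k : R) x y : x <= y ->
  integral_on (cst k) x y = k * (y - x).
Proof.
move=> xy; rewrite /integral_on Rintegral_cst //.
congr (k * _); rewrite [RHS](_ : _ = fine (mu `]x, y])) //.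
rewrite lebesgue_measure_itv /= lte_fin.
by case: ltP => // yx; rewrite (_ : y = x) ?subrr //; apply/le_anti/andP.
Qed.

Lemma integral_support f x y : (forall t, t <= x -> f t = 0) ->
  (forall t, y <= t -> f t = 0) -> \int[mu]_t f t = integral_on f x y.
Proof.
move=> fx fy; rewrite /integral_on [RHS]Rintegral_mkcond; apply: eq_Rintegral => t _.
rewrite patchE; case: ifPn => //; rewrite notin_setE /= in_itv /= => /negP.
by rewrite negb_and -leNgt -ltNge => /orP[/fx|/ltW/fy].
Qed.

Definition square_integrable g :=
  measurable_fun setT g /\ mu.-integrable setT (EFin \o (fun t => g t ^+ 2)).

Lemma square_integrable_sqr g : square_integrable g ->
  interval_integrable (fun t => g t ^+ 2).
Proof. by move=> [_ gi] x y; apply: integrableS gi. Qed.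

Lemma square_integrable_interval g : square_integrable g -> interval_integrable g.
Proof.
move=> gg; have [mg gi] := gg.
apply: (@interval_integrable_le _ (fun t => 1 + g t ^+ 2)) => //.
  move=> t; rewrite [leRHS]ger0_norm ?addr_ge0 ?sqr_ge0 //.
  rewrite -[g t ^+ 2]real_normK ?num_real //.
  by have := sqr_ge0 (`|g t| - 1); have := normr_ge0 (g t); nra.
apply: interval_integrableD; first exact: interval_integrable_cst.
exact: square_integrable_sqr.
Qed.

(** The increments of this function of [x] bound the integrals of [g] over
    intervals, and they telescope over cells. *)
Definition cumulative_energy g x : R := \int[mu]_(t in `]-oo, x]) g t ^+ 2.

Lemma cumulative_energyB g x y : square_integrable g -> x <= y ->
  cumulative_energy g y - cumulative_energy g x = integral_on (fun t => g t ^+ 2) x y.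
Proof.
move=> [_ gi] xy.
apply: (@Rintegral_itvB R (fun t => g t ^+ 2) -oo%O (BRight y) x) => //.
by apply: integrableS gi.
Qed.

Lemma cumulative_energy_mono g x y : square_integrable g -> x <= y ->
  cumulative_energy g x <= cumulative_energy g y.
Proof.
move=> gg xy; rewrite -subr_ge0 cumulative_energyB //.
by apply: integral_on_ge0 => t; exact: sqr_ge0.
Qed.

Lemma cumulative_energy_ge0 g x : 0 <= cumulative_energy g x.
Proof. by apply: Rintegral_ge0 => t _; exact: sqr_ge0. Qed.

Lemma cumulative_energy_le g x : square_integrable g ->
  cumulative_energy g x <= \int[mu]_t g t ^+ 2.
Proof.
move=> [mg gi]; rewrite /cumulative_energy /Rintegral fine_le //.
- by apply: integrable_fin_num => //; apply: integrableS gi.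
- by apply: integrable_fin_num.
apply: ge0_subset_integral => //; first exact: (measurable_int mu gi).
by move=> t _; rewrite lee_fin sqr_ge0.
Qed.

(** The Cauchy-Schwarz inequality, from [2 s |g| <= s^2 + g^2] with the best
    constant [s]. *)
Lemma integral_on_sqr_le g x y : square_integrable g -> x <= y ->
  integral_on (fun t => `|g t|) x y ^+ 2
  <= (y - x) * (cumulative_energy g y - cumulative_energy g x).
Proof.
move=> gg xy; have [mg gi] := gg.
rewrite cumulative_energyB //.
set X := integral_on _ x y; set b := integral_on _ x y.
have X0 : 0 <= X by apply: integral_on_ge0.
have b0 : 0 <= b by apply: integral_on_ge0 => t; exact: sqr_ge0.
have igg := square_integrable_sqr gg.
have ig := interval_integrable_norm (square_integrable_interval gg).
have Xs s : 0 < s -> 2 * s * X <= s ^+ 2 * (y - x) + b.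
  move=> s0; rewrite /X -integral_onZ // -integral_on_cst // /b -integral_onD //;
    last exact: interval_integrable_cst.
  apply: integral_on_le.
  - exact: interval_integrableZ.
  - by apply: interval_integrableD => //; exact: interval_integrable_cst.
  - move=> t _; rewrite -[g t ^+ 2]real_normK ?num_real //.
    by have := sqr_ge0 (s - `|g t|); rewrite /=; nra.
have [x_y|] := eqVneq x y.
  by rewrite /X x_y /integral_on set_itvoc0 Rintegral_set0 expr0n subrr mul0r.
move=> nxy; have a0 : 0 < y - x by rewrite subr_gt0 lt_neqAle nxy.
have [->|X0'] := eqVneq X 0; first by rewrite expr0n mulr_ge0 // ltW.
have Xgt0 : 0 < X by rewrite lt_def X0'.
have := Xs (X / (y - x)) (divr_gt0 Xgt0 a0).
rewrite -(ler_pM2l a0).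
have -> : (y - x) * (2 * (X / (y - x)) * X) = 2 * X ^+ 2 by field; lra.
have -> : (y - x) * ((X / (y - x)) ^+ 2 * (y - x) + b) = X ^+ 2 + (y - x) * b by field; lra.
lra.
Qed.

End IntervalIntegral.

(** * Weak derivatives and cell means *)

Section WeakDerivative.
Variable R : realType.
Implicit Types (f g u phi : R -> R) (x y z c d h : R).
Notation mu := (@lebesgue_measure R).

Lemma smooth_continuous f : smooth f -> continuous f.
Proof.
move=> sf x; apply: differentiable_continuous.
by apply/derivable1_diffP; exact: (sf 0%N x).
Qed.

Lemma smooth_measurable f : smooth f -> measurable_fun setT f.
Proof. by move=> sf; apply: continuous_measurable_fun; exact: smooth_continuous. Qed.

Lemma smooth_primitive_exists f c : smooth f -> (forall t, t <= c -> f t = 0) ->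
  exists2 F : R -> R, (forall x, is_derive x 1 F (f x)) & forall x, x <= c -> F x = 0.
Proof.
move=> sf fc; pose F x := \int[mu]_(t in `[c - 1, x]) f t.
have F0 x : x <= c -> F x = 0.
  move=> xc; rewrite /F (@eq_Rintegral _ _ _ mu _ (cst 0) f) ?Rintegral_cst ?mul0r //.
  move=> t; rewrite inE /= in_itv /= => /andP[_ tx].
  exact: fc (le_trans tx xc).
exists F => // x.
have [xc|cx] := ltP x c.
  rewrite fc ?(ltW xc) //; apply: (@near_eq_is_derive _ _ _ (cst 0)).
  by near=> y; rewrite F0 //; near: y; exact: lt_le_nbhsl.
have cx1 : c - 1 < x by rewrite ltrBlDr (le_lt_trans cx) // ltrDl.
have fint : mu.-integrable `[c - 1, x + 1] (EFin \o f).
  apply: continuous_compact_integrable; first exact: segment_compact.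
  by apply: continuous_subspaceT; exact: smooth_continuous.
have xx1 : x < x + 1 by rewrite ltrDl.
have [dF Ff] := continuous_FTC1_closed xx1 fint cx1 (@smooth_continuous f sf x).
apply: DeriveDef; first exact: dF.
by rewrite -derive1E; exact: Ff.
Unshelve. all: by end_near. Qed.

(** Dominated convergence against bounded multipliers. *)
Lemma cvg_integral_on u (b_ : nat -> R -> R) (b : R -> R) (B : R) x y :
  measurable_fun setT u -> interval_integrable u ->
  (forall n, measurable_fun setT (b_ n)) -> measurable_fun setT b ->
  (forall n t, `|b_ n t| <= B) -> (forall t, `|b t| <= B) ->
  (forall t, x < t <= y -> b_ n t @[n --> \oo] --> b t) ->
  integral_on (fun t => u t * b_ n t) x y @[n --> \oo] -->
    integral_on (fun t => u t * b t) x y.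
Proof.
move=> mu_ ui mb_ mb bB_ bB bcvg.
have Bu : mu.-integrable `]x, y] (EFin \o (fun t => B * `|u t|)).
  exact: (interval_integrableZ B (interval_integrable_norm ui) x y).
have mub n : measurable_fun (`]x, y]%classic : set R) (fun t => (u t * b_ n t)%:E).
  apply/measurable_EFinP; apply: (@measurable_funS _ _ _ _ setT) => //.
  exact: measurable_funM.
have mub' : measurable_fun (`]x, y]%classic : set R) (fun t => (u t * b t)%:E).
  apply/measurable_EFinP; apply: (@measurable_funS _ _ _ _ setT) => //.
  exact: measurable_funM.
have := @dominated_convergence _ _ R mu _ (measurable_itv `]x, y])
  (fun n t => (u t * b_ n t)%:E) (fun t => (u t * b t)%:E) _ mub mub' _ Bu _.
case.
- apply: aeW => t /= xty; apply: cvg_EFin; first by near=> n.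
  by apply: cvgMr; apply: bcvg; rewrite in_itv in xty.
- apply: aeW => t n _; rewrite /= lee_fin normrM mulrC ler_wpM2r //.
- move=> _ _ h; apply: fine_cvg; rewrite fineK; first exact: h.
  apply: integrable_fin_num => //.
  exact: (interval_integrableM mu_ ui mb bB).
Unshelve. all: by end_near. Qed.

Lemma integral_on_open f x y : interval_integrable f ->
  integral_on (fun t => f t * \1_(`]x, y[%classic : set R) t) x y = integral_on f x y.
Proof.
move=> fi; rewrite /integral_on.
have -> : (fun t => f t * \1_(`]x, y[%classic : set R) t) = f \_ `]x, y[%classic.
  apply/funext => t; rewrite patchE indicE.
  by case: (_ \in _); rewrite ?mulr1 ?mulr0.
rewrite -Rintegral_mkcondr.
have -> : `]x, y]%classic `&` `]x, y[%classic = `]x, y[%classic :> set R.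
  by apply: setIidr; exact: subset_itv_oo_oc.
apply: Rintegral_itv_bndo_bndc; apply: integrableS (fi x y) => //.
exact: subset_itv_oo_oc.
Qed.

Lemma le_flat_exp1 x y : x <= y -> flat_exp 1 x <= flat_exp 1 y.
Proof.
move=> xy; have [x0|x0] := ltP 0 x; last first.
  by rewrite {1}/flat_exp ltNge x0 /= flat_exp1_ge0.
have y0 : 0 < y by exact: lt_le_trans xy.
rewrite /flat_exp x0 y0 !hornerC !mul1r ler_expR lerN2.
by rewrite lef_pV2 // posrE.
Qed.

(** A test function whose derivative is a plateau minus its translate: testing
    against it compares the means of a function over two nearby intervals. *)
Lemma translated_plateau_primitive c d h eps : c < d -> 0 < h -> 0 < eps ->
  exists phi : R -> R, [/\ smooth phi,
    forall z, is_derive z 1 phi (plateau c d eps z - plateau c d eps (z - h)) &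
    forall z, exists2 t, z - h < t < z & phi z = h * plateau c d eps t].
Proof.
move=> cd h0 eps0.
have [H dH _] := @smooth_primitive_exists _ c (@smooth_plateau R c d eps)
  (fun t tc => plateau_eq0 eps0 (introT orP (or_introl tc))).
have sH : smooth H by exact: smooth_primitive (@smooth_plateau R c d eps) dH.
have sh f : smooth f -> smooth (fun z => f (z - h)).
  move=> sf; have := @smooth_affine _ f 1 (- h) sf.
  by under eq_fun do rewrite mul1r.
have dHh z : is_derive z 1 (fun z => H (z - h)) (plateau c d eps (z - h)).
  have d1 : is_derive z 1 (fun z => z - h) 1.
    by apply: is_derive_eq; rewrite subr0.
  have := @is_derive1_comp R H (fun z => z - h) z _ _ (dH _) d1.
  by rewrite mulr1.
exists (fun z => H z - H (z - h)); split.
- by apply: smoothB; [exact: sH|exact: sh].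
- by move=> z; exact: is_deriveB.
move=> z; have zh : z - h < z by rewrite ltrBlDr ltrDl.
have [|t tz ->] := @MVT R H (plateau c d eps) (z - h) z zh (fun x _ => dH x).
  by apply: continuous_subspaceT; exact: smooth_continuous.
by exists t; [rewrite in_itv in tz|rewrite opprB addrCA subrr addr0 mulrC].
Qed.

Lemma test_function_support L phi c d : smooth phi -> d < L ->
  (forall z, z <= c -> phi z = 0) -> (forall z, d <= z -> phi z = 0) ->
  test_function `]-oo, L[%classic phi.
Proof.
move=> sphi dL phic phid.
have sub : closure [set z | phi z != 0] `<=` `[c, d]%classic.
  rewrite closureE => z; apply; split; first exact: itv_closed.
  move=> t /=; apply: contraNP; rewrite in_itv /= => /negP.
  by rewrite negb_and -!ltNge => /orP[/ltW/phic ->|/ltW/phid ->].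
split=> //.
- apply: (subclosed_compact _ (@segment_compact R c d) sub).
  exact: closed_closure.
- by move=> z /sub /=; rewrite !in_itv /= => /andP[_ zd]; exact: le_lt_trans dL.
Qed.

(** The analytic content of weak differentiability: the means of [u] over two
    intervals differing by a translation [h] differ by [h] times the mean of
    [g], up to the mass of [g] near the end points. *)
Lemma weak_derivative_increment L u g c d h :
  square_integrable u -> square_integrable g ->
  (forall phi, test_function `]-oo, L[%classic phi ->
     \int[mu]_t (u t * derive1 phi t) = - \int[mu]_t (g t * phi t)) ->
  0 < h -> c + h <= d -> d + h < L ->
  `|integral_on u (c + h) (d + h) - integral_on u c d - h * integral_on g c d|
  <= 2 * h * (integral_on (fun t => `|g t|) c (c + h)
              + integral_on (fun t => `|g t|) d (d + h)).
Proof.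
move=> uu gg W h0 chd dhL.
have cch : c < c + h by rewrite ltrDl.
have cd : c < d by exact: lt_le_trans chd.
have ddh : d < d + h by rewrite ltrDl.
have [mu_ _] := uu; have [mg _] := gg.
have ui := square_integrable_interval uu; have gi := square_integrable_interval gg.
have gni := interval_integrable_norm gi.
pose eta n := plateau c d (n.+1%:R^-1).
have e0 n : 0 < n.+1%:R^-1 :> R by rewrite invr_gt0 ltr0Sn.
have eta0 n z : (z <= c) || (d <= z) -> eta n z = 0 by exact: plateau_eq0.
have meta n : measurable_fun setT (eta n) by apply: smooth_measurable; exact: smooth_plateau.
have eta1 n z : `|eta n z| <= 1 by rewrite ger0_norm ?plateau_ge0 ?plateau_le1.
pose phi n := sval (cid (translated_plateau_primitive cd h0 (e0 n))).
have phiP n : [/\ smooth (phi n),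
    forall z, is_derive z 1 (phi n) (eta n z - eta n (z - h)) &
    forall z, exists2 t, z - h < t < z & phi n z = h * eta n t].
  exact: (svalP (cid (translated_plateau_primitive cd h0 (e0 n)))).
have phi_c n z : z <= c -> phi n z = 0.
  move=> zc; have [_ _ /(_ z) [t /andP[_ tz] ->]] := phiP n.
  by rewrite eta0 ?mulr0 // (le_trans (ltW tz) zc).
have phi_d n z : d + h <= z -> phi n z = 0.
  move=> zd; have [_ _ /(_ z) [t /andP[tz _] ->]] := phiP n.
  rewrite eta0 ?mulr0 //; apply/orP; right.
  by rewrite (le_trans _ (ltW tz)) // lerBrDr.
have phi_h n z : 0 <= phi n z <= h.
  have [_ _ /(_ z) [t _ ->]] := phiP n.
  by rewrite mulr_ge0 ?(ltW h0) ?plateau_ge0 //= ger_pMr // plateau_le1.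
have phi_n n z : `|phi n z| <= h.
  by case/andP: (phi_h n z) => p0 ph; rewrite ger0_norm.
have mphi n : measurable_fun setT (phi n).
  by apply: smooth_measurable; case: (phiP n).
have test n : test_function `]-oo, L[%classic (phi n).
  apply: (@test_function_support L _ c (d + h)) => //.
  - by case: (phiP n).
  - exact: phi_c.
  - exact: phi_d.
have dphi n z : derive1 (phi n) z = eta n z - eta n (z - h).
  have [_ /(_ z) dd _] := phiP n.
  by rewrite derive1E (@derive_val _ _ _ _ _ _ _ dd).
have meta_h n : measurable_fun setT (fun z => eta n (z - h)).
  apply: smooth_measurable.
  have := @smooth_affine _ (eta n) 1 (- h) (@smooth_plateau R _ _ _).
  by under eq_fun do rewrite mul1r.
have gphi_i n : interval_integrable (fun t => g t * phi n t).
  exact: (interval_integrableM mg gi (mphi n) (phi_n n)).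
pose A n := integral_on (fun t => u t * eta n t) c d.
pose A' n := integral_on (fun t => u t * eta n (t - h)) (c + h) (d + h).
pose B n := integral_on (fun t => g t * phi n t) (c + h) d.
have W_n n : A n - A' n = - integral_on (fun t => g t * phi n t) c (d + h).
  have := W _ (test n).
  rewrite [X in _ = - X](@integral_support _ _ c (d + h)); last 2 first.
  - by move=> t tc; rewrite phi_c ?mulr0.
  - by move=> t td; rewrite phi_d ?mulr0.
  rewrite [X in X = _](@integral_support _ _ c (d + h)); last 2 first.
  - by move=> t tc; rewrite dphi !eta0 ?subrr ?mulr0 ?tc // lerBlDr (le_trans tc) // ltW.
  - move=> t td; rewrite dphi !eta0 ?subrr ?mulr0 //.
      by apply/orP; right; rewrite lerBrDr.
    by apply/orP; right; rewrite (le_trans _ td) // ltW.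
  have i1 := interval_integrableM mu_ ui (meta n) (eta1 n).
  have i2 := interval_integrableM mu_ ui (meta_h n) (fun z => eta1 n (z - h)).
  move=> <-; under [RHS]eq_integral_on do rewrite dphi mulrBr.
  rewrite integral_onB //; congr (_ - _).
    rewrite (integral_on_chasles i1 (ltW cd) (ltW ddh)) [X in _ + X](_ : _ = 0) ?addr0 //.
    rewrite (eq_integral_on (g := cst 0)) ?integral_on_cst ?mul0r ?(ltW ddh) //.
    by move=> t /andP[dt _]; rewrite eta0 ?mulr0 // (ltW dt) orbT.
  rewrite (integral_on_chasles i2 (ltW cch) (_ : c + h <= d + h)) ?lerD2r ?(ltW cd) //.
  rewrite [X in X + _](_ : _ = 0) ?add0r //.
  rewrite (eq_integral_on (g := cst 0)) ?integral_on_cst ?mul0r ?(ltW cch) //.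
  by move=> t /andP[_ tc]; rewrite eta0 ?mulr0 // lerBlDr tc.
have B_n n : `|A n - A' n + B n| <=
    h * (integral_on (fun t => `|g t|) c (c + h) + integral_on (fun t => `|g t|) d (d + h)).
  rewrite W_n (integral_on_chasles (gphi_i n) (ltW cch) (_ : c + h <= d + h)); last first.
    by rewrite lerD2r ltW.
  rewrite (integral_on_chasles (gphi_i n) chd (ltW ddh)).
  set a := integral_on _ c _; set b := integral_on _ d _; rewrite -/(B n).
  rewrite (_ : - _ + B n = - a - b); last by ring.
  have edge x y : `|integral_on (fun t => g t * phi n t) x y| <=
      h * integral_on (fun t => `|g t|) x y.
    rewrite (le_trans (norm_integral_on_le _ _ (gphi_i n))) // -integral_onZ //.
    apply: integral_on_le; first exact: interval_integrable_norm.
      exact: interval_integrableZ.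
    by move=> t _; rewrite normrM mulrC ler_wpM2r.
  by rewrite (le_trans (ler_normB _ _)) // normrN mulrDr lerD ?edge.
have ind1 x y t : `|\1_(`]x, y[%classic : set R) t| <= 1 :> R.
  by rewrite indicE; case: (_ \in _); rewrite ?normr1 ?normr0.
have mind x y : measurable_fun setT (\1_(`]x, y[%classic : set R) : R -> R).
  exact: measurable_indic.
have cvgA : A n @[n --> \oo] --> integral_on u c d.
  rewrite -(integral_on_open c d ui).
  apply: (@cvg_integral_on _ _ _ 1) => // t _; exact: cvg_plateau.
have cvgA' : A' n @[n --> \oo] --> integral_on u (c + h) (d + h).
  rewrite -(integral_on_open (c + h) (d + h) ui).
  apply: (@cvg_integral_on _ _ _ 1) => // t _.
  have -> : \1_(`]c + h, d + h[%classic : set R) t =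
      \1_(`]c, d[%classic : set R) (t - h) :> R.
    rewrite !indicE; congr (nat_of_bool _)%:R.
    by apply/idP/idP; rewrite !inE /= !in_itv /= ltrBrDr ltrBlDr.
  exact: cvg_plateau.
have cvgB_ : B n @[n --> \oo] --> h * integral_on g (c + h) d.
  have -> : h * integral_on g (c + h) d = integral_on
      (fun t => g t * (h * \1_(`]c + h, d[%classic : set R) t)) (c + h) d.
    rewrite -integral_onZ // -(integral_on_open (c + h) d (interval_integrableZ h gi)).
    by apply: eq_integral_on => t _; rewrite mulrCA mulrA.
  have -> : B = fun n => integral_on
      (fun t => g t * (phi n t * \1_(`]c + h, d[%classic : set R) t)) (c + h) d.
    apply/funext => n; rewrite /B -(integral_on_open (c + h) d (gphi_i n)).
    by apply: eq_integral_on => t _; rewrite mulrA.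
  apply: (@cvg_integral_on _ _ _ h) => //.
  - by move=> n; exact: measurable_funM.
  - exact: measurable_funM.
  - move=> n t; rewrite normrM -[h]mulr1; apply: ler_pM => //.
  - by move=> t; rewrite normrM gtr0_norm // ger_pMr.
  move=> t _; rewrite !indicE; have [|tn] := boolP (t \in _); last first.
    by rewrite mulr0; under eq_fun do rewrite mulr0; exact: cvg_cst.
  rewrite inE /= in_itv /= => /andP[ct td].
  under eq_fun do rewrite mulr1.
  rewrite mulr1.
  have tch : 0 < t - h - c by rewrite !subr_gt0 ltrBrDr.
  have dt : 0 < d - t by rewrite subr_gt0.
  have low := cvgM (cvg_flat_exp1 tch) (cvg_flat_exp1 dt).
  move/(_ eventually_filter): low; rewrite [X in _ --> X -> _]mulr1 => low.
  have low_h := @cvgMr _ _ _ _ _ h _ low.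
  rewrite mulr1 in low_h.
  change ((fun n => phi n t) @ \oo --> h).
  apply: (squeeze_cvgr _ (low_h _) (cvg_cst h)).
  near=> n; apply/andP; split; last by case/andP: (phi_h n t).
  have [_ _ /(_ t) [s /andP[hs st] ->]] := phiP n.
  rewrite ler_wpM2l ?(ltW h0) // /eta /plateau.
  apply: ler_pM; rewrite ?flat_exp1_ge0 // le_flat_exp1 // ler_pM2l ?invr_gt0 //.
    by rewrite lerD2r ltW.
  by rewrite lerD2l lerN2 ltW.
have lim_le : `|integral_on u c d - integral_on u (c + h) (d + h)
      + h * integral_on g (c + h) d| <=
    h * (integral_on (fun t => `|g t|) c (c + h) + integral_on (fun t => `|g t|) d (d + h)).
  have hc0 := cvg_norm (cvgD (cvgB cvgA cvgA') cvgB_).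
  have hc := hc0 eventually_filter eventually_filter eventually_filter.
  have <- := cvg_lim (@Rhausdorff R) hc.
  apply: limr_le; first by apply/cvg_ex; eexists; exact: hc.
  by apply: nearW => n; exact: B_n.
have := norm_integral_on_le c (c + h) gi.
rewrite (integral_on_chasles gi (ltW cch) chd).
have : 0 <= integral_on (fun t => `|g t|) d (d + h) by exact: integral_on_ge0.
move: lim_le; set U := integral_on u c d; set V := integral_on u _ _.
set X := integral_on (fun t => `|g t|) c _; set Y := integral_on (fun t => `|g t|) d _.
set a := integral_on g c _; set b := integral_on g _ d => lim_le Y0 aX.
rewrite (_ : V - U - h * (a + b) = - (U - V + h * b) - h * a); last by ring.
rewrite (le_trans (ler_normB _ _)) // normrN normrM gtr0_norm //.
have : h * `|a| <= h * X by rewrite ler_wpM2l // ltW.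
have : 0 <= h * Y by rewrite mulr_ge0 // ltW.
lra.
Unshelve. all: by end_near. Qed.

End WeakDerivative.

Section CellMean.
Variable R : realType.
Implicit Types (f g u : R -> R) (x y z c d h dx : R).
Notation mu := (@lebesgue_measure R).

Definition cell_mean dx g x : R := dx^-1 * integral_on g (x - dx) x.

Definition l2_energy g : R := \int[mu]_t g t ^+ 2.

Lemma l2_energy_ge0 g : 0 <= l2_energy g.
Proof. by apply: Rintegral_ge0 => t _; exact: sqr_ge0. Qed.

Lemma integral_on_sqrt_le g x y : square_integrable g -> x <= y ->
  integral_on (fun t => `|g t|) x y <= Num.sqrt ((y - x) * l2_energy g).
Proof.
move=> gg xy; rewrite -[leLHS]ger0_norm ?integral_on_ge0 // -sqrtr_sqr.
rewrite ler_wsqrtr // (le_trans (integral_on_sqr_le gg xy)) //.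
rewrite ler_wpM2l ?subr_ge0 // lerBlDr ler_wpDr ?cumulative_energy_ge0 //.
exact: cumulative_energy_le.
Qed.

Lemma cell_mean_increment dx g x y : 0 < dx -> square_integrable g ->
  x <= y -> y <= x + dx ->
  `|cell_mean dx g y - cell_mean dx g x|
  <= 2 / dx * Num.sqrt ((y - x) * l2_energy g).
Proof.
move=> dx0 gg xy ydx.
have gi := square_integrable_interval gg.
have i1 := integral_on_sqrt_le gg xy.
have xydx : x - dx <= y - dx by rewrite lerD2r.
have ydx' : y - dx <= x by rewrite lerBlDr.
have i2 := integral_on_sqrt_le gg xydx.
rewrite (_ : y - dx - (x - dx) = y - x) in i2; last by ring.
rewrite /cell_mean -mulrBr.
rewrite (integral_on_chasles gi ydx' xy) (integral_on_chasles gi xydx ydx').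
rewrite (_ : integral_on g (y - dx) x + integral_on g x y - _ =
   integral_on g x y - integral_on g (x - dx) (y - dx)); last by ring.
have := norm_integral_on_le x y gi; have := norm_integral_on_le (x - dx) (y - dx) gi.
rewrite normrM ger0_norm ?invr_ge0 ?(ltW dx0) // mulrAC mulrC => h1 h2.
rewrite ler_wpM2r ?invr_ge0 ?(ltW dx0) // (le_trans (ler_normB _ _)) //.
rewrite mulr_natl mulr2n; apply: lerD; first exact: le_trans h2 i1.
exact: le_trans h1 i2.
Qed.

Lemma sqrt_small (E e : R) : 0 <= E -> 0 < e -> exists2 d : R, 0 < d &
  forall h, 0 <= h -> h < d -> Num.sqrt (h * E) <= e.
Proof.
move=> E0 e0; have E1 : 0 < E + 1 by rewrite ltr_wpDl.
exists (e ^+ 2 / (E + 1)); first by rewrite divr_gt0 ?exprn_gt0.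
move=> h h0; rewrite ltr_pdivlMr // => hE.
rewrite -[e]ger0_norm ?(ltW e0) // -sqrtr_sqr ler_wsqrtr // (le_trans _ (ltW hE)) //.
by rewrite ler_wpM2l // lerDl.
Qed.

Lemma cell_mean_continuous dx g : 0 < dx -> square_integrable g ->
  continuous (cell_mean dx g).
Proof.
move=> dx0 gg x; apply/cvgrPdist_le => e e0.
have e0' : 0 < e * dx / 2 by rewrite !divr_gt0 ?mulr_gt0.
have [d d0 Hd] := sqrt_small (l2_energy_ge0 g) e0'.
have mono y z : y <= z -> z - y < d -> z - y < dx ->
    `|cell_mean dx g z - cell_mean dx g y| <= e.
  move=> yz zyd zydx.
  rewrite (le_trans (cell_mean_increment dx0 gg yz _)) //; first by lra.
  rewrite (le_trans (ler_wpM2l _ (Hd _ _ zyd))) ?subr_ge0 //.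
    by rewrite divr_ge0 // ltW.
  by rewrite le_eqVlt; apply/orP; left; apply/eqP; field; lra.
have m0 : 0 < Num.min d dx by rewrite lt_min d0.
near=> y.
have yd : `|x - y| < Num.min d dx.
  by near: y; exact: (nbhsx_ballx x _ m0).
move: yd; rewrite lt_min; have [xy|yx] := leP x y.
  by rewrite distrC ger0_norm ?subr_ge0 // => /andP[h1 h2]; rewrite distrC mono.
rewrite ger0_norm ?subr_ge0 ?(ltW yx) // => /andP[h1 h2].
by rewrite mono // ltW.
Unshelve. all: by end_near. Qed.

(** In [weak_derivative_increment], the mass of [g] on intervals of length [h]
    is [O(sqrt h)], so the error is [o(h)]. *)
Lemma is_derive_cell_mean dx L u g x : 0 < dx -> x < L ->
  square_integrable u -> square_integrable g ->
  (forall phi, test_function `]-oo, L[%classic phi ->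
     \int[mu]_t (u t * derive1 phi t) = - \int[mu]_t (g t * phi t)) ->
  is_derive x 1 (cell_mean dx u) (cell_mean dx g x).
Proof.
move=> dx0 xL uu gg W; apply: is_derive_of_modulus => e e0.
have e0' : 0 < e * dx / 6 by rewrite !divr_gt0 ?mulr_gt0.
have [d d0 Hd] := sqrt_small (l2_energy_ge0 g) e0'.
(* For negative increments the estimate is applied from [x + h], and the
   derivative is then moved back to [x] by continuity. *)
have right y h : y < L -> 0 < h -> h < d -> h <= dx -> y + h < L ->
    `|cell_mean dx u (y + h) - cell_mean dx u y - h * cell_mean dx g y|
    <= 4 / 6 * e * h.
  move=> yL h0 hd hdx yhL.
  have chd : y - dx + h <= y by lra.
  have := weak_derivative_increment uu gg W h0 chd yhL.
  have le1 : y - dx <= y - dx + h by lra.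
  have le2 : y <= y + h by lra.
  have i1 := integral_on_sqrt_le gg le1.
  have i2 := integral_on_sqrt_le gg le2.
  rewrite [_ - (y - dx)]addrC addKr in i1.
  rewrite [_ - y]addrC addKr in i2.
  have Hh := Hd h (ltW h0) hd.
  rewrite /cell_mean (_ : y + h - dx = y - dx + h); last by ring.
  move=> H; rewrite mulrCA -!mulrBr normrM ger0_norm ?invr_ge0 ?(ltW dx0) //.
  rewrite mulrC ler_pdivrMr // (le_trans H) //.
  have := ler_wpM2l (ltW h0) (le_trans (lerD i1 i2) (lerD Hh Hh)).
  lra.
exists (Num.min d (Num.min dx (L - x))).
  by rewrite !lt_min d0 dx0 subr_gt0.
move=> h; rewrite !lt_min => /and3P[hd hdx hL].
have [h0|h0] := leP h 0; last first.
  rewrite gtr0_norm // in hd hdx hL *.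
  rewrite (le_trans (right x h xL h0 hd (ltW hdx) _)) //; first by lra.
  by rewrite ler_wpM2r ?(ltW h0) //; lra.
move: h0; rewrite le_eqVlt => /predU1P[->|h0].
  by rewrite addr0 subrr mul0r subrr normr0 mulr0.
rewrite ltr0_norm // in hd hdx hL *.
have k0 : 0 < - h by rewrite oppr_gt0.
have xhL : x + h < L by lra.
have xhhL : x + h - h < L by rewrite addrK.
have := right (x + h) (- h) xhL k0 hd (ltW hdx) xhhL; rewrite addrK.
have xhx : x + h <= x by lra.
have xhdx : x <= x + h + dx by lra.
have := cell_mean_increment dx0 gg xhx xhdx.
rewrite (_ : x - (x + h) = - h); last by ring.
have Hh := Hd (- h) (ltW k0) hd.
set a := cell_mean dx u (x + h); set b := cell_mean dx u x.
set q := cell_mean dx g x; set q' := cell_mean dx g (x + h) => h1 h2.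
have h3 : `|q - q'| <= 2 / 6 * e.
  rewrite (le_trans h1) // (le_trans (ler_wpM2l _ Hh)) ?divr_ge0 ?(ltW dx0) //.
  by rewrite le_eqVlt; apply/orP; left; apply/eqP; field; lra.
rewrite (_ : a - b - h * q = - (b - a - - h * q') + - h * (q - q')); last by ring.
rewrite (le_trans (ler_normD _ _)) // normrN normrM gtr0_norm //.
have := ler_wpM2l (ltW k0) h3.
lra.
Qed.

(** Only the energy of one cell occurs on the right, which is what makes the
    truncation errors summable over the cells. *)
Lemma cell_mean_sqr_le dx g x : 0 < dx -> square_integrable g ->
  cell_mean dx g x ^+ 2
  <= dx^-1 * (cumulative_energy g x - cumulative_energy g (x - dx)).
Proof.
move=> dx0 gg; have xdx : x - dx <= x by rewrite gerBl ltW.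
have := integral_on_sqr_le gg xdx; rewrite subKr => h.
have gi := square_integrable_interval gg.
rewrite exprMn -[integral_on g _ x ^+ 2]real_normK ?num_real //.
have : `|integral_on g (x - dx) x| ^+ 2 <= integral_on (fun t => `|g t|) (x - dx) x ^+ 2.
  by rewrite ler_sqr ?nnegrE ?integral_on_ge0 // norm_integral_on_le.
move=> /le_trans /(_ h) {}h.
rewrite expr2 -mulrA ler_wpM2l ?invr_ge0 ?(ltW dx0) //.
by rewrite ler_pdivrMl.
Qed.

End CellMean.

(** * Taylor polynomials and finite differences *)

Section Taylor.
Variable R : realType.
Implicit Types (f : nat -> R -> R) (x b B L : R) (m : nat) (q : {poly R}).

Definition taylor_poly f m b : {poly R} :=
  \sum_(i < m) (f i b / i`!%:R) *: ('X - b%:P) ^+ i.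

Lemma size_taylor_poly f m b : (size (taylor_poly f m b) <= m)%N.
Proof.
apply: (leq_trans (size_sum _ _ _)); apply/bigmax_leqP => i _.
by rewrite (leq_trans (size_scale_leq _ _)) // size_exp_XsubC.
Qed.

Lemma taylor_polyS f m b : taylor_poly f m.+1 b =
  taylor_poly f m b + (f m b / m`!%:R) *: ('X - b%:P) ^+ m.
Proof. by rewrite /taylor_poly big_ord_recr. Qed.

Lemma deriv_taylor_poly f m b :
  (taylor_poly f m.+1 b)^`() = taylor_poly (fun i => f i.+1) m b.
Proof.
rewrite /taylor_poly big_ord_recl derivD expr0 derivZ derivC scaler0 add0r.
rewrite raddf_sum; apply: eq_bigr => i _.
rewrite /= derivZ deriv_exp derivXsubC mul1r /= /bump /= add1n.
rewrite -[_ ^+ i *+ _]scaler_nat scalerA; congr (_ *: _).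
by rewrite factS natrM invfM mulrA mulrAC divfK ?pnatr_eq0.
Qed.

Lemma taylor_poly_base f m b : (taylor_poly f m.+1 b).[b] = f 0%N b.
Proof.
rewrite /taylor_poly big_ord_recl expr0 hornerD hornerZ hornerC mulr1 divr1.
rewrite horner_sum big1 ?addr0 // => i _.
by rewrite hornerZ horner_exp hornerXsubC subrr expr0n mulr0.
Qed.

(** Taylor's estimate on the left of the base point, which may be the end [L]
    of the domain of derivability. *)
Lemma taylor_remainder m f L b x B :
  (forall i, (i < m)%N -> continuous (f i)) ->
  (forall i t, (i < m)%N -> t < L -> is_derive t 1 (f i) (f i.+1 t)) ->
  b <= L -> x <= b -> (forall t, x <= t <= b -> `|f m t| <= B) ->
  `|f 0%N x - (taylor_poly f m b).[x]| <= B * (b - x) ^+ m.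
Proof.
move=> + + bL; elim: m f x => [|m IH] f x fc df xb fB.
  rewrite /taylor_poly big_ord0 horner0 subr0 expr0 mulr1 fB // lexx xb //.
pose g t := f 0%N t - (taylor_poly f m.+1 b).[t].
pose dg t := f 1%N t - (taylor_poly (fun i => f i.+1) m b).[t].
have gd t : t \in `]x, b[ -> is_derive t 1 g (dg t).
  rewrite in_itv /= => /andP[_ tb]; rewrite /dg -deriv_taylor_poly.
  have d1 := df 0%N t (ltn0Sn _) (lt_le_trans tb bL).
  exact: is_deriveB.
have gc : {within `[x, b], continuous g}.
  apply: continuous_subspaceT => t; apply: cvgB; first exact: fc.
  exact: continuous_horner.
have [t txb] := MVT_segment xb gd gc.
rewrite {1}/g taylor_poly_base subrr sub0r => /eqP.
rewrite eqr_oppLR => /eqP; rewrite -/(g x) => ->.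
move: txb; rewrite in_itv /= => /andP[xt tb].
rewrite normrN normrM [`|b - x|]ger0_norm ?subr_ge0 // exprSr mulrA.
rewrite ler_wpM2r ?subr_ge0 //.
have B0 : 0 <= B by rewrite (le_trans _ (fB x _)) ?lexx.
apply: (@le_trans _ _ (B * (b - t) ^+ m)).
  apply: (IH (fun i => f i.+1)) => //.
  - by move=> i im; exact: fc.
  - by move=> i s im sL; exact: df.
  - by move=> s /andP[ts sb]; apply: fB; rewrite (le_trans xt).
rewrite ler_wpM2l // lerXn2r ?nnegrE ?subr_ge0 // lerD2l lerN2 //.
Qed.

End Taylor.

Section PolynomialSamples.
Variables (R : realType).
Implicit Types (q : {poly R}) (w : int -> R).
Local Notation D := (@backward_diff R).

Lemma size_diff_translate q (c : R) :
  (size (q - (q \Po ('X - c%:P)))%R <= (size q).-1)%N.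
Proof.
have s2 : size ('X - c%:P) = 2 by exact: size_XsubC.
apply/leq_sizeP => j qj. rewrite coefD coefN.
have [qj'|jq] := leqP (size q) j.
  by rewrite !nth_default ?subrr // size_comp_poly2.
have -> : j = (size q).-1 by lia.
have -> : q`_(size q).-1 = lead_coef q by rewrite lead_coefE.
have -> : (q \Po ('X - c%:P))`_(size q).-1 = lead_coef (q \Po ('X - c%:P)).
  by rewrite lead_coefE size_comp_poly2.
by rewrite lead_coef_comp ?s2 // lead_coefXsubC expr1n mulr1 subrr.
Qed.

(** A difference lowers the degree of a polynomial by one. *)
Lemma iter_diff_horner n q (dx s : R) (j : int) : (size q <= n)%N ->
  iter n D (fun i => q.[i%:~R * dx - s]) j = 0.
Proof.
elim: n q j => [|n IH] q j.
  by rewrite leqn0 size_poly_eq0 => /eqP -> /=; rewrite horner0.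
move=> qn; rewrite iterSr.
have -> : D (fun i => q.[i%:~R * dx - s]) =
    fun i => (q - (q \Po ('X - dx%:P))).[i%:~R * dx - s].
  apply/funext => i; rewrite /backward_diff hornerD hornerN horner_comp.
  rewrite !hornerE rmorphB /=; congr (_ - _.[_]); ring.
by apply: IH; rewrite (leq_trans (size_diff_translate _ _)) //; lia.
Qed.

Lemma iter_diffD n w w' j :
  iter n D (fun i => w i + w' i) j = iter n D w j + iter n D w' j.
Proof.
elim: n j => [|n IH] j //=.
by rewrite /backward_diff !IH opprD addrACA.
Qed.

Lemma iter_diff_bound n w j (B : R) :
  (forall i, j - n%:Z <= i <= j -> `|w i| <= B) -> `|iter n D w j| <= 2 ^+ n * B.
Proof.
elim: n j => [|n IH] j wB /=; first by rewrite mul1r wB //; lia.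
rewrite /backward_diff (le_trans (ler_normB _ _)) // exprS -mulrA mulr_natl mulr2n.
by rewrite lerD // IH // => i ij; apply: wB; lia.
Qed.

(** The moment conditions say that the scheme transports polynomials of degree
    at most [k] exactly, with velocity [nu] cells per step. *)
Lemma scheme_step_horner (r p k : nat) (a_ : int -> R) (nu : R) q (dx s : R) (j : int) :
  (forall i, (i <= k)%N -> \sum_(l <- stencil r p) l%:~R ^+ i * a_ l = (- nu) ^+ i) ->
  (size q <= k.+1)%N ->
  scheme_step r p a_ (fun i => q.[i%:~R * dx - s]) j = q.[j%:~R * dx - s - nu * dx].
Proof.
move=> moments qk; rewrite /scheme_step.
have taylor (y : R) : q.[j%:~R * dx - s + y * dx] =
    \sum_(i < k.+1) q^`N(i).[j%:~R * dx - s] * dx ^+ i * y ^+ i.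
  rewrite (nderiv_taylor_wide _ qk); last exact: mulrC.
  by apply: eq_bigr => i _; rewrite exprMn mulrAC mulrA.
under eq_bigr => l _.
  have -> : (j + l)%:~R * dx - s = j%:~R * dx - s + l%:~R * dx.
    by rewrite rmorphD /= mulrDl addrAC.
  rewrite taylor mulr_sumr.
  under eq_bigr do rewrite [a_ l * _]mulrC -[_ * a_ l]mulrA.
  over.
rewrite exchange_big /= -mulNr taylor; apply: eq_bigr => i _.
by rewrite -moments -1?ltnS // mulr_sumr.
Qed.

End PolynomialSamples.

(** * Consistency *)

Section Consistency.
Variables (R : realType) (r p k : nat) (a_ : int -> R) (nu : R).
Local Notation D := (@backward_diff R).
Local Notation T := (scheme_step r p a_).

Hypothesis nu_ge0 : 0 <= nu.
Hypothesis moments : forall i, (i <= k)%N ->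
  \sum_(l <- stencil r p) l%:~R ^+ i * a_ l = (- nu) ^+ i.

Variables (dx L : R) (J : int) (m : nat) (f : nat -> R -> R).
Hypothesis dx_gt0 : 0 < dx.
Hypothesis L_def : J%:~R * dx = L.
Hypothesis mk : (m <= k.+1)%N.
Hypothesis f_cont : forall i, (i < m)%N -> continuous (f i).
Hypothesis f_deriv : forall i t, (i < m)%N -> t < L -> is_derive t 1 (f i) (f i.+1 t).

(** A discrete counterpart of the extension of Sobolev functions across the
    boundary, for which both the scheme in the last interior cells and the
    boundary condition are consistent. The argument [s] is the distance
    travelled by the exact solution. *)
Definition ghost_extension (s : R) (j : int) : R :=
  if j <= J then f 0%N (j%:~R * dx - s)
  else (taylor_poly f m (J%:~R * dx - s)).[j%:~R * dx - s].

Lemma cell_le (i j : int) (s : R) : (i%:~R * dx - s <= j%:~R * dx - s) = (i <= j).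
Proof. by rewrite lerD2r ler_pM2r // ler_int. Qed.

(** The values read by the scheme agree with one Taylor polynomial up to the
    remainder, and the scheme is exact on that polynomial. *)
Lemma truncation_error (W : nat) (s B : R) (j : int) :
  0 <= s -> j <= J -> (p + r <= W)%N -> p%:R + nu <= W%:R -> 0 <= B ->
  (forall t, (j - W%:Z)%:~R * dx - s <= t <= (j + p%:Z)%:~R * dx - s -> t <= L ->
     `|f m t| <= B) ->
  `|T (ghost_extension s) j - f 0%N (j%:~R * dx - s - nu * dx)|
  <= (coef_norm r p a_ + 1) * (B * (W%:R * dx) ^+ m).
Proof.
move=> s0 jJ prW pnW B0 fB.
(* The base point is the right end of the stencil, moved back to the boundary
   if necessary; the ghost values then lie exactly on the polynomial. *)
pose c := if j + p%:Z <= J then j + p%:Z else J.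
have cJ : c <= J by rewrite /c; case: ifP.
have cjp : c <= j + p%:Z by rewrite /c; case: ifP; lia.
have jc : j <= c by rewrite /c; case: ifP; lia.
pose b := c%:~R * dx - s; pose q := taylor_poly f m b.
have bL : b <= L by rewrite -L_def lerBlDr ler_wpDr // ler_pM2r // ler_int.
pose E := B * (W%:R * dx) ^+ m.
have Wdx0 : 0 <= W%:R * dx by rewrite mulr_ge0 ?ler0n // ltW.
have taylor x : x <= b -> b - x <= W%:R * dx ->
    (j - W%:Z)%:~R * dx - s <= x -> `|f 0%N x - q.[x]| <= E.
  move=> xb bx xlow.
  rewrite (le_trans (@taylor_remainder _ m f L b x B f_cont f_deriv bL xb _)) //.
    move=> t /andP[xt tb]; apply: fB; last exact: le_trans bL.
    by rewrite (le_trans xlow xt) (le_trans tb) // cell_le.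
  by rewrite /E ler_wpM2l // lerXn2r // nnegrE // subr_ge0.
have samples i : j - r%:Z <= i <= j + p%:Z ->
    `|ghost_extension s i - q.[i%:~R * dx - s]| <= E.
  move=> ij; rewrite /ghost_extension; case: ifPn => iJ; last first.
    have -> : J = c by rewrite /c; case: ifP => // h; move: iJ; lia.
    by rewrite -/b -/q subrr normr0 mulr_ge0 // exprn_ge0.
  have ic : i <= c by rewrite /c; case: ifP; lia.
  apply: taylor; rewrite /b ?cell_le //.
  - rewrite opprB addrA subrK -mulrBl ler_pM2r // -intrB pmulrn ler_int.
    by move: cjp jc; lia.
  - by move: prW ij; lia.
have qk : (size q <= k.+1)%N by rewrite (leq_trans (size_taylor_poly _ _ _)).
have Tq := scheme_step_horner dx s j moments qk.
have split_v : T (ghost_extension s) j =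
    T (fun i => ghost_extension s i - q.[i%:~R * dx - s]) j
    + T (fun i => q.[i%:~R * dx - s]) j.
  by rewrite -scheme_stepD; congr (T _ j); apply/funext => i; rewrite subrK.
rewrite split_v Tq -addrA -[q.[_] - _]opprB.
rewrite (le_trans (ler_normB _ _)) // mulrDl mul1r lerD //.
  exact: scheme_step_bound.
apply: taylor.
- rewrite /b lerBlDr ler_wpDr ?mulr_ge0 ?(ltW dx_gt0) //.
  by rewrite cell_le.
- rewrite /b (_ : _ - _ = ((c - j)%:~R + nu) * dx); last by rewrite rmorphB /=; ring.
  rewrite ler_pM2r // (le_trans _ pnW) // lerD2r pmulrn ler_int; move: cjp; lia.
- rewrite rmorphB /= mulrBl addrAC lerD2l lerN2 ler_pM2r //.
  by rewrite -pmulrn (le_trans _ pnW) // lerDr ler0n.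
Qed.

(** The condition of order [kb >= k0] annihilates the Taylor polynomial of
    degree less than [k0], and the remainder is governed by the derivative of
    order [k0]. *)
Lemma ghost_difference (kb k0 : nat) (s B : R) (j : int) :
  0 <= s -> m = k0.+1 -> (k0 <= kb)%N -> 0 <= B ->
  (forall t, t <= L -> `|f k0 t| <= B) ->
  j <= J + p%:Z -> J <= j ->
  `|iter kb D (ghost_extension s) j| <= 2 ^+ kb * (B * ((p + kb)%:R * dx) ^+ k0).
Proof.
move=> s0 mk0 k0kb B0 fB jp Jj.
pose b := J%:~R * dx - s; pose q := taylor_poly f k0 b.
have bL : b <= L by rewrite -L_def lerBlDr lerDl.
rewrite (_ : ghost_extension s = fun i =>
   (ghost_extension s i - q.[i%:~R * dx - s]) + q.[i%:~R * dx - s]); last first.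
  by apply/funext => i; rewrite subrK.
rewrite iter_diffD iter_diff_horner ?addr0; last first.
  by rewrite (leq_trans (size_taylor_poly _ _ _)).
have pdx0 : 0 <= (p + kb)%:R * dx by rewrite mulr_ge0 ?ler0n // ltW.
apply: iter_diff_bound => i ij; rewrite /ghost_extension; case: ifPn => iJ.
  have ib : i%:~R * dx - s <= b by rewrite cell_le.
  have fc' i' : (i' < k0)%N -> continuous (f i').
    by move=> h; apply: f_cont; rewrite mk0; exact: leqW.
  have fd' i' t : (i' < k0)%N -> t < L -> is_derive t 1 (f i') (f i'.+1 t).
    by move=> h; apply: f_deriv; rewrite mk0; exact: leqW.
  rewrite (le_trans (@taylor_remainder _ k0 f L b _ B fc' fd' bL ib _)) //.
    by move=> t /andP[_ tb]; apply: fB; exact: le_trans bL.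
  rewrite ler_wpM2l // lerXn2r // ?nnegrE ?subr_ge0 //.
  rewrite /b opprB addrA subrK -mulrBl ler_pM2r // -intrB pmulrn ler_int.
  by move: ij Jj; clear; lia.
rewrite mk0 taylor_polyS hornerD addrC addKr hornerZ horner_exp hornerXsubC.
rewrite normrM ler_pM //.
  rewrite normrM -[leRHS]mulr1 ler_pM // ?fB // ger0_norm ?invr_ge0 ?ler0n //.
  by rewrite invf_le1 ?ltr0n ?fact_gt0 // ler1n fact_gt0.
rewrite normrX /b (_ : _ - _ = (i - J)%:~R * dx); last by rewrite rmorphB /=; ring.
have iJ0 : 0 <= i - J by move: iJ; clear; lia.
rewrite lerXn2r ?nnegrE // ger0_norm ?mulr_ge0 ?ler0z ?(ltW dx_gt0) //.
rewrite ler_pM2r // pmulrn ler_int; move: ij jp; clear; lia.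
Qed.

End Consistency.

Section Telescoping.
Variable R : realType.

(** Windows of bounded width overlap boundedly, hence the energies they contain
    add up to at most a multiple of the total energy. *)
Lemma sum_window_le (G : int -> R) (E : R) (J c : int) (w M : nat) :
  (forall i, 0 <= G i <= E) ->
  \sum_(i < M) (G (J - i%:Z + c) - G (J - i%:Z + c - w%:Z)) <= w%:R * E.
Proof.
move=> GE; elim: w => [|w IH].
  by rewrite mul0r big1 // => i _; rewrite subr0 subrr.
have -> : \sum_(i < M) (G (J - i%:Z + c) - G (J - i%:Z + c - w.+1%:Z)) =
  \sum_(i < M) (G (J - i%:Z + c) - G (J - i%:Z + c - w%:Z)) +
  \sum_(i < M) (G (J + c - w%:Z - i%:Z) - G (J + c - w%:Z - i.+1%:Z)).
  rewrite -big_split; apply: eq_bigr => i _ /=.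
  have -> : J + c - w%:Z - i%:Z = J - i%:Z + c - w%:Z by lia.
  have -> : J + c - w%:Z - i.+1%:Z = J - i%:Z + c - w.+1%:Z by lia.
  by rewrite addrA subrK.
rewrite -natr1 mulrDl mul1r lerD //.
have -> : \sum_(i < M) (G (J + c - w%:Z - i%:Z) - G (J + c - w%:Z - i.+1%:Z)) =
    G (J + c - w%:Z) - G (J + c - w%:Z - M%:Z).
  elim: M {IH} => [|M IH]; first by rewrite big_ord0 subr0 subrr.
  by rewrite big_ord_recr IH /= addrA subrK.
have /andP[_ h1] := GE (J + c - w%:Z).
have /andP[h2 _] := GE (J + c - w%:Z - M%:Z).
by rewrite lerBlDr ler_wpDr.
Qed.

(** A one-dimensional Sobolev embedding for functions known through the
    energies of their cells: average over cells covering a unit length. *)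
Lemma discrete_sobolev (f g : R -> R) (F G : R -> R) (dx E0 E1 x : R) :
  0 < dx -> continuous f -> (forall t, t < x -> is_derive t 1 f (g t)) ->
  (forall t, 0 <= F t <= E0) -> (forall t, 0 <= G t <= E1) ->
  (forall s t, s <= t -> G s <= G t) ->
  (forall t, f t ^+ 2 <= dx^-1 * (F t - F (t - dx))) ->
  (forall t, g t ^+ 2 <= dx^-1 * (G t - G (t - dx))) ->
  f x ^+ 2 <= 2 * E0 + 4 * (1 + dx) * E1.
Proof.
move=> dx0 fc fd FE GE Gmono fF gG.
pose y (j : int) : R := x + j%:~R * dx.
have yS j : y (j - 1) = y j - dx by rewrite /y rmorphB /=; ring.
have y0 : y 0 = x by rewrite /y mul0r addr0.
have E10 : 0 <= E1 by have /andP[h1 h2] := GE 0; exact: le_trans h2.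
(* the number of cells needed to cover a unit length *)
pose M := (Num.trunc dx^-1).+1.
have M1 : 1 <= M%:R * dx.
  by rewrite -ler_pdivrMr // mul1r ltW // /M truncnS_gt.
have M2 : M%:R * dx <= 1 + dx.
  rewrite /M -natr1 mulrDl mul1r lerD2r -ler_pdivlMr // div1r.
  by rewrite truncn_le // invr_ge0 ltW.
have M0 : 0 < M%:R :> R by rewrite ltr0n.
have jump (q : nat) : (f (y (0 - q%:Z)) - f (y (0 - q.+1%:Z))) ^+ 2 <=
    dx * (G (y (0 - q%:Z)) - G (y (0 - q%:Z - 2))).
  have -> : 0 - q.+1%:Z = 0 - q%:Z - 1 by lia.
  rewrite yS; set t := y (0 - q%:Z).
  have tx : t <= x.
    by rewrite -y0 /t /y lerD2l ler_pM2r // ler_int; lia.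
  have tdx : t - dx <= t by rewrite gerBl ltW.
  have [||s] := @MVT_segment R f g (t - dx) t tdx.
  - by move=> s; rewrite in_itv /= => /andP[_ st]; apply: fd; exact: lt_le_trans tx.
  - exact: continuous_subspaceT.
  rewrite in_itv /= => /andP[ts st] ->.
  rewrite opprB addrCA subrr addr0 exprMn.
  have -> : dx * (G t - G (y (0 - q%:Z - 2))) =
     dx^-1 * (G t - G (t - dx - dx)) * dx ^+ 2.
    have -> : y (0 - q%:Z - 2) = t - dx - dx.
      by rewrite /t /y !rmorphB /=; ring.
    by field; lra.
  rewrite ler_wpM2r ?sqr_ge0 // (le_trans (gG s)) // ler_wpM2l ?invr_ge0 ?(ltW dx0) //.
  by rewrite lerB // Gmono // lerD2r.
have osc (i : 'I_M) : (f x - f (y (0 - i%:Z))) ^+ 2 <= (1 + dx) * (2 * E1).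
  have : `|f x - f (y (0 - i%:Z))| <=
      \sum_(q < M) `|f (y (0 - q%:Z)) - f (y (0 - q.+1%:Z))|.
    have iM := ltnW (ltn_ord i).
    have := @oscillation_le R M 0 (fun j => f (y j)) 0 i (leq0n _) iM.
    rewrite subr0 y0 => /le_trans; apply; rewrite le_eqVlt; apply/orP; left; apply/eqP.
    apply: eq_bigr => q _; rewrite /backward_diff.
    by have -> : 0 - q.+1%:Z = 0 - q%:Z - 1 by lia.
  set S := \sum_(q < M) _ => hS.
  have S0 : 0 <= S by apply: sumr_ge0.
  rewrite -[_ ^+ 2]real_normK ?num_real //.
  rewrite (@le_trans _ _ (S ^+ 2)) ?ler_sqr ?nnegrE //.
  rewrite (le_trans (sqr_sum_le M (fun q => `|f (y (0 - q%:Z)) - f (y (0 - q.+1%:Z))|))) //.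
  have : \sum_(q < M) `|f (y (0 - q%:Z)) - f (y (0 - q.+1%:Z))| ^+ 2 <= dx * (2 * E1).
    rewrite (@le_trans _ _ (\sum_(q < M) dx * (G (y (0 - q%:Z)) - G (y (0 - q%:Z - 2))))) //.
      by apply: ler_sum => q _; rewrite real_normK ?num_real.
    rewrite -mulr_sumr ler_wpM2l ?(ltW dx0) //.
    have := @sum_window_le (fun j => G (y j)) E1 0 0 2 M (fun j => GE _).
    by under eq_bigr do rewrite addr0.
  move=> /(ler_wpM2l (ltW M0)) /le_trans; apply.
  by rewrite [M%:R * (dx * _)]mulrA ler_wpM2r // mulr_ge0.
have : M%:R * dx * f x ^+ 2 <= 2 * E0 + M%:R * dx * (4 * (1 + dx) * E1).
  have -> : M%:R * dx * f x ^+ 2 = dx * \sum_(i < M) f x ^+ 2.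
    by rewrite sumr_const card_ord -mulr_natl; ring.
  have h : \sum_(i < M) f x ^+ 2 <=
      2 * \sum_(i < M) f (y (0 - i%:Z)) ^+ 2 + M%:R * (4 * (1 + dx) * E1).
    have -> : M%:R * (4 * (1 + dx) * E1) = \sum_(i < M) 4 * (1 + dx) * E1.
      by rewrite sumr_const card_ord mulr_natl.
    rewrite mulr_sumr -big_split; apply: ler_sum => i _; have := osc i.
    rewrite /=; move: (f x) (f (y (0 - i%:Z))) => z t zt; have := sqr_ge0 (z - 2 * t).
    have -> : (z - 2 * t) ^+ 2 = 2 * (z - t) ^+ 2 + 2 * t ^+ 2 - z ^+ 2 by ring.
    by move: zt; rewrite (mulrA (1 + dx)); lra.
  rewrite (le_trans (ler_wpM2l (ltW dx0) h)) // mulrDr [dx * (M%:R * _)]mulrA [dx * M%:R]mulrC.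
  rewrite lerD2r mulrCA ler_wpM2l // mulr_sumr.
  have := @sum_window_le (fun j => F (y j)) E0 0 0 1 M (fun j => FE _).
  rewrite mul1r; apply: le_trans; apply: ler_sum => i _.
  rewrite addr0 (_ : 0 - i%:Z - 1%N%:Z = 0 - i%:Z - 1) // yS.
  by rewrite -ler_pdivlMl // fF.
have E00 : 0 <= E0 by have /andP[h1 h2] := FE 0; exact: le_trans h2.
have : 2 * E0 <= M%:R * dx * (2 * E0) by rewrite ler_peMl // mulr_ge0.
move=> h1 h2; have : M%:R * dx * f x ^+ 2 <= M%:R * dx * (2 * E0 + 4 * (1 + dx) * E1).
  by rewrite mulrDr; lra.
by rewrite ler_pM2l ?mulr_gt0.
Qed.

End Telescoping.

(** * Cell means of Sobolev functions *)

Section Translation.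
Variable R : realType.
Notation mu := (@lebesgue_measure R).

Definition translate (s : R) : measurableTypeR R -> measurableTypeR R :=
  fun y : R => y - s.

Lemma measurable_translate s : measurable_fun setT (translate s).
Proof. exact: measurable_funB. Qed.

Lemma lebesgue_measure_translate (s : R) (A : set R) : measurable A ->
  pushforward mu (translate s) A = mu A.
Proof.
move=> mA.
have mphi := measurable_translate s.
pose phi : {mfun measurableTypeR R >-> measurableTypeR R} := HB.pack (translate s)
  (isMeasurableFun.Build _ _ _ _ _ mphi).
rewrite -[LHS]/(pushforward mu phi A).
apply/esym/lebesgue_measure_unique => //= _ [[a b]] _ <-.
rewrite /pushforward.
have -> : translate s @^-1` `]a, b] = `]a + s, b + s]%classic.
  by apply/seteqP; split=> y /=; rewrite /translate !in_itv /= ltrBrDr lerBlDr.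
rewrite !lebesgue_measure_itv /= !lte_fin ltrD2r.
by case: ifP => // _; rewrite -!EFinB; congr EFin; ring.
Qed.

Lemma ge0_integral_translate (f : R -> \bar R) (s c d : R) :
  measurable_fun setT f -> (forall t, 0 <= f t)%E ->
  (\int[mu]_(y in `]c, d[) f (y - s)%R = \int[mu]_(y in `](c - s)%R, (d - s)%R[) f y)%E.
Proof.
move=> mf f0.
have mphi := measurable_translate s.
have -> : `]c, d[%classic = translate s @^-1` `]c - s, d - s[%classic.
  by apply/seteqP; split=> y /=; rewrite /translate !in_itv /= ltrBrDr subrK ltrD2r.
transitivity (\int[pushforward mu (translate s)]_(y in `](c - s)%R, (d - s)%R[) f y)%E.
  apply/esym; apply: (ge0_integral_pushforward mphi) => //.
  exact: measurable_funS mf.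
by apply: eq_measure_integral => A mA _; exact: lebesgue_measure_translate.
Qed.

Lemma Rintegral_translate (f : R -> R) (s c d : R) : measurable_fun setT f ->
  \int[mu]_(y in `]c, d[) f (y - s) = \int[mu]_(y in `]c - s, d - s[) f y.
Proof.
move=> mf; rewrite /Rintegral integralE [in RHS]integralE.
have mE : measurable_fun setT (EFin \o f) by exact/measurable_EFinP.
have hpos := ge0_integral_translate s c d (measurable_funepos mE) (fun t => funepos_ge0 _ t).
have hneg := ge0_integral_translate s c d (measurable_funeneg mE) (fun t => funeneg_ge0 _ t).
congr (fine (_ - _)%E).
- by rewrite -[RHS]hpos; apply: eq_integral => y _; rewrite !funeposE.
- by rewrite -[RHS]hneg; apply: eq_integral => y _; rewrite !funenegE.
Qed.

Lemma cell_average_translate (u : R -> R) (L dx s : R) (j : int) :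
  0 < dx -> 0 <= s -> j%:~R * dx <= L -> measurable_fun setT (u \_ `]-oo, L[) ->
  interval_integrable (u \_ `]-oo, L[) ->
  cell_average dx (fun y => u (y - s)) j =
  cell_mean dx (u \_ `]-oo, L[) (j%:~R * dx - s).
Proof.
move=> dx0 s0 jL mu_ ui; rewrite /cell_average /cell_mean; congr (_ * _).
transitivity (\int[mu]_(y in `](j - 1)%:~R * dx, j%:~R * dx[) (u \_ `]-oo, L[) (y - s)).
  apply: eq_Rintegral => y; rewrite inE /= in_itv /= => /andP[_ yj].
  rewrite patchE mem_set //= in_itv /= ltrBlDr (lt_le_trans yj) //.
  by rewrite (le_trans jL) // lerDl.
rewrite Rintegral_translate // /integral_on.
have -> : (j - 1)%:~R * dx - s = j%:~R * dx - s - dx.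
  by rewrite rmorphB /=; ring.
apply: Rintegral_itv_bndo_bndc; apply: integrableS (ui _ _) => //.
exact: subset_itv_oo_oc.
Qed.

End Translation.

Section SobolevMeans.
Variable R : realType.
Variable L : R.
Notation mu := (@lebesgue_measure R).
Let Omega : set R := `]-oo, L[%classic.
Implicit Types (u g phi : R -> R).

Lemma Rintegral_restrict u phi :
  \int[mu]_(x in Omega) (u x * phi x) = \int[mu]_x ((u \_ Omega) x * phi x).
Proof.
rewrite Rintegral_mkcond; apply: eq_Rintegral => x _; rewrite !patchE.
by case: ifP => // _; rewrite mul0r.
Qed.

(** Where a function vanishes near a point, so does its derivative. *)
Lemma test_function_derive phi : test_function Omega phi ->
  test_function Omega (derive1 phi).
Proof.
move=> [sphi cphi subphi].
have sub : closure [set x | derive1 phi x != 0] `<=` closure [set x | phi x != 0].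
  rewrite [X in X `<=` _]closureE => x; apply; split; first exact: closed_closure.
  move=> y /=; apply: contraNP => ny.
  have ny' : (~` closure [set x | phi x != 0]) y by [].
  have op : open (~` closure [set x | phi x != 0]).
    by apply: closed_openC; exact: closed_closure.
  have near0 : \near y, cst 0 y = phi y.
    near=> z; have : (~` closure [set x | phi x != 0]) z.
      by near: z; exact: open_nbhs_nbhs.
    move=> /= nz; apply/esym/eqP; apply: contra_notT nz => pz.
    exact: subset_closure.
  rewrite derive1E -(near_eq_derive _ near0) //.
  by rewrite derive_cst.
split.
- by move=> n x; have := sphi n.+1 x; rewrite /derive1n iterSr.
- by apply: (subclosed_compact _ cphi sub); exact: closed_closure.
- by move=> x /sub /subphi.
Unshelve. all: by end_near. Qed.

Lemma weak_derivative_succ u g g' i :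
  is_weak_derivative Omega i u g -> is_weak_derivative Omega i.+1 u g' ->
  forall phi, test_function Omega phi ->
  \int[mu]_x ((g \_ Omega) x * derive1 phi x) = - \int[mu]_x ((g' \_ Omega) x * phi x).
Proof.
move=> [_ Hg] [_ Hg'] phi tphi.
have := Hg _ (test_function_derive tphi); have := Hg' _ tphi.
have -> : (phi^`(i.+1))%classic = ((derive1 phi)^`(i))%classic.
  by rewrite /derive1n iterSr.
move=> ->; rewrite -!Rintegral_restrict exprS mulN1r mulNr => /eqP.
rewrite -mulrN (inj_eq (mulfI _)) ?signr_eq0 // => /eqP <-.
by [].
Qed.

(** At [x = L] the cell touches the end of the domain, where there are no test
    functions; the equality there comes from continuity. *)
Lemma eq_cell_mean u g dx x : 0 < dx ->
  square_integrable u -> square_integrable g ->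
  (forall phi, test_function Omega phi ->
    \int[mu]_t (u t * phi t) = \int[mu]_t (g t * phi t)) ->
  x <= L -> cell_mean dx u x = cell_mean dx g x.
Proof.
move=> dx0 uu gg H.
have lt_L t : t < L -> cell_mean dx u t = cell_mean dx g t.
  move=> tL; congr (_ * _).
  pose eta n := plateau (t - dx) t (n.+1%:R^-1).
  have seta n : smooth (eta n) by exact: smooth_plateau.
  have e0 n : 0 < n.+1%:R^-1 :> R by rewrite invr_gt0 ltr0Sn.
  have eta0 n z : (z <= t - dx) || (t <= z) -> eta n z = 0 by exact: plateau_eq0.
  have cvg_u w : square_integrable w ->
      \int[mu]_t (w t * eta n t) @[n --> \oo] --> integral_on w (t - dx) t.
    move=> ww; have wi := square_integrable_interval ww; have [mw _] := ww.
    rewrite -(integral_on_open (t - dx) t wi).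
    have -> : (fun n => \int[mu]_t (w t * eta n t)) =
        fun n => integral_on (fun z => w z * eta n z) (t - dx) t.
      apply/funext => n; apply: integral_support => z zt.
        by rewrite eta0 ?mulr0 // zt.
      by rewrite eta0 ?mulr0 // zt orbT.
    have meta n : measurable_fun setT (eta n) by exact: smooth_measurable.
    have mind : measurable_fun setT (\1_(`]t - dx, t[%classic : set R) : R -> R).
      exact: measurable_indic.
    have eta1 n z : `|eta n z| <= 1.
      by rewrite ger0_norm ?plateau_ge0 ?plateau_le1.
    have ind1 z : `|\1_(`]t - dx, t[%classic : set R) z| <= 1 :> R.
      by rewrite indicE; case: (_ \in _); rewrite ?normr1 ?normr0.
    by apply: (@cvg_integral_on _ _ _ _ 1) => // z _; exact: cvg_plateau.
  apply: (cvg_unique _ (cvg_u u uu)) => //.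
  have -> : (fun n => \int[mu]_t (u t * eta n t)) = fun n => \int[mu]_t (g t * eta n t).
    apply/funext => n; apply: H.
    apply: (@test_function_support _ L _ (t - dx) t) => //.
      by move=> z zt; rewrite eta0 // zt.
    by move=> z zt; rewrite eta0 // zt orbT.
  exact: cvg_u.
rewrite le_eqVlt => /predU1P[->|]; last exact: lt_L.
have cu := cvg_at_left_filter (cell_mean_continuous dx0 uu (x := L)).
have cg := cvg_at_left_filter (cell_mean_continuous dx0 gg (x := L)).
apply: (cvg_unique _ cu) => //.
apply: cvg_trans cg; apply: near_eq_cvg; near=> t.
by apply/esym/lt_L; near: t; exact: nbhs_left_lt.
Unshelve. all: by end_near. Qed.

Lemma sobolev_norm_ge0 m u : (0 <= sobolev_norm Omega m u)%E.
Proof. exact: poweR_ge0. Qed.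

(** The norm is computed from the very representatives chosen by
    [weak_derivative], which a finite norm therefore makes square integrable. *)
Lemma sobolev_norm_energy m u : (sobolev_norm Omega m u < +oo)%E ->
  (forall i, (i <= m)%N -> measurable_fun Omega (weak_derivative Omega i u)) ->
  forall i, (i <= m)%N ->
  square_integrable (weak_derivative Omega i u \_ Omega) /\
  l2_energy (weak_derivative Omega i u \_ Omega) <= fine (sobolev_norm Omega m u) ^+ 2.
Proof.
move=> fin meas i im.
pose N i := ('N[mu]_2%:E [EFin \o (weak_derivative Omega i u) \_ Omega])%E.
have N0 i' : (0 <= N i')%E by exact: Lnorm_ge0.
have N20 i' : (0 <= N i' ^+ 2)%E by exact: expe_ge0.
set g := _ \_ Omega.
have mg : measurable_fun setT g.
  apply/(measurable_restrictT _ _).1; last exact: meas.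
  exact: measurable_itv.
pose S := (\sum_(i < m.+1) N i ^+ 2)%E.
have S0 : (0 <= S)%E by exact: sume_ge0.
have Sfin : (S < +oo)%E by rewrite (@lty_poweRy _ _ 2^-1).
have NS : (N i ^+ 2 <= S)%E.
  have im' : (i < m.+1)%N by [].
  rewrite /S (bigD1 (Ordinal im')) //= leeDl //.
  by apply: sume_ge0 => j _; exact: N20.
have Ni_fin : N i \is a fin_num.
  rewrite ge0_fin_numE //; apply: contraTT (le_lt_trans NS Sfin).
  by rewrite -leNgt leye_eq => /eqP ->; rewrite expe2 mulyy ltxx.
have energyE : (N i ^+ 2 = \int[mu]_t (g t ^+ 2)%:E)%E.
  have -> : (N i ^+ 2 = N i `^ 2)%E.
    by rewrite -(fineK Ni_fin) poweR_EFin powR_mulrn ?fine_ge0 // EFin_expe.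
  rewrite /N poweR_Lnorm //; apply: eq_integral => t _ /=.
  by rewrite powR_mulrn // real_normK ?num_real.
have gfin : (\int[mu]_t (g t ^+ 2)%:E < +oo)%E by rewrite -energyE (le_lt_trans NS).
have gint : mu.-integrable setT (EFin \o (fun t => g t ^+ 2)).
  apply/integrableP; split; first exact/measurable_EFinP/measurable_funX.
  by under eq_integral do rewrite /= ger0_norm ?sqr_ge0 //.
split=> //.
have Sfin_num : S \is a fin_num by rewrite ge0_fin_numE.
have -> : fine (sobolev_norm Omega m u) ^+ 2 = fine S.
  rewrite /sobolev_norm -/S -(fineK Sfin_num) poweR_EFin /=.
  by rewrite powR12_sqrt ?fine_ge0 // sqr_sqrtr ?fine_ge0.
rewrite /l2_energy /Rintegral -energyE fine_le //.
by rewrite energyE ge0_fin_numE // integral_ge0 // => t _; rewrite lee_fin sqr_ge0.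
Qed.

End SobolevMeans.

(** * Convergence *)

Section Convergence.
Variable R : realType.
Notation mu := (@lebesgue_measure R).
Local Notation D := (@backward_diff R).

Lemma in_L2_square_integrable (Omega : set R) (u : R -> R) :
  in_L2 Omega u -> square_integrable (u \_ Omega).
Proof.
move=> uL2; split; last exact: Lfun2_integrable_sqr.
by move: uL2; rewrite /in_L2 inE => /andP[]; rewrite inE.
Qed.

Lemma weak_derivativeP (Omega : set R) (k i : nat) (u : R -> R) :
  in_sobolev Omega k u -> (i <= k)%N ->
  is_weak_derivative Omega i u (weak_derivative Omega i u).
Proof.
move=> [_ H] /H[g ug _]; apply: (@xgetPex _ (cst 0) [set g | is_weak_derivative Omega i u g]).
by exists g.
Qed.

(** The discrete estimate: stability applied to the error, whose sources are
    bounded by [truncation_error] and [ghost_difference]. *)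
Lemma l2_convergence (a lambda : R) (k kb r p : nat) (a_ : int -> R) :
  0 < a -> 0 < lambda -> (0 < k)%N -> (0 < r)%N -> a_ (- r%:Z) != 0 ->
  (forall m : nat, (m <= k)%N ->
     \sum_(l <- stencil r p) l%:~R ^+ m * a_ l = (- (lambda * a)) ^+ m) ->
  (forall theta : R, 0 <= theta <= 2 * pi ->
     ComplexField.Normc.normc (symbol r p a_ theta) <= 1) ->
  let k0 := minn k kb in
  exists2 C : R, 0 < C &
    forall (T : R) (J : nat) (L : R) (u0 : R -> R),
      0 < T -> (0 < J)%N -> 0 < L ->
      in_sobolev `]-oo, L[ k.+1 u0 ->
      (sobolev_norm `]-oo, L[ k0.+1 u0 < +oo)%E ->
      let dx := L / J%:R in
      let dt := lambda * dx in
      dt < 1 ->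
      forall u : nat -> int -> R,
        scheme_solution kb r p a_ T dt dx J u0 u ->
        let err (n : nat) (j : int) :=
          u n j - cell_average dx (fun y => u0 (y - a * (n%:R * dt))) j in
        forall n, n%:R <= T / dt -> forall M,
        dx * sqnorm J%:Z M (err n)
        <= (C * (Num.sqrt T + T) * dx ^+ k0
            * fine (sobolev_norm `]-oo, L[ k0.+1 u0)) ^+ 2.
Proof.
move=> a0 lambda0 k_gt0 r_gt0 ar0 moments symb k0.
pose nu := lambda * a.
have nu0 : 0 < nu by rewrite mulr_gt0.
have moment0 : \sum_(l <- stencil r p) a_ l = 1.
  by rewrite -[RHS](expr0 (- nu)) -moments //; apply: eq_bigr => l _; rewrite mul1r.
have moment1 : \sum_(l <- stencil r p) l%:~R * a_ l = - nu.
  by rewrite -[RHS]expr1 -moments.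
have [Cs Cs0 stab] := stability r_gt0 nu0 moment0 moment1 ar0 symb kb.
pose W := (p + r + (Num.trunc nu).+1)%N.
have prW : (p + r <= W)%N by exact: leq_addr.
have pnW : p%:R + nu <= W%:R.
  rewrite /W natrD [(p + r)%N%:R]natrD -addrA lerD2l ler_wpDl ?ler0n //.
  by rewrite ltW // truncnS_gt.
pose A := coef_norm r p a_ + 1.
(* K1 measures the truncation error in the interior, K2 the defect of the
   boundary condition; the interior windows have W + 1 + p cells. *)
pose K1 := A ^+ 2 * W%:R ^+ (2 * k0.+1) * (W + 1 + p)%:R.
pose K2 := p%:R * 2 ^+ kb * (p + kb)%:R ^+ k0 * Num.sqrt (2 + 4 * (1 + lambda^-1)).
have K10 : 0 <= K1 by rewrite !mulr_ge0 ?exprn_ge0 ?ler0n ?addr_ge0 ?coef_norm_ge0.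
have K20 : 0 <= K2 by rewrite !mulr_ge0 ?exprn_ge0 ?ler0n ?sqrtr_ge0.
pose K := K2 ^+ 2 / lambda + K1 / lambda ^+ 2.
have K0 : 0 <= K.
  by rewrite addr_ge0 // divr_ge0 ?exprn_ge0 ?(ltW lambda0).
exists (Num.sqrt (Cs * K + 1)).
  by rewrite sqrtr_gt0 ltr_wpDl // mulr_ge0.
move=> T J L u0 T0 J0 L0 sob fin dx dt dt1 u [u_init u_ghost u_step] err.
have JR : 0 < J%:R :> R by rewrite ltr0n.
have dx0 : 0 < dx by rewrite divr_gt0.
have dt0 : 0 < dt by rewrite mulr_gt0.
have dx1 : dx <= lambda^-1 by rewrite -[leRHS]mul1r ler_pdivlMr // mulrC ltW.
have LJ : (J%:Z)%:~R * dx = L by rewrite -pmulrn mulrC divfK ?lt0r_neq0.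
pose m := k0.+1.
have k0k : (k0 <= k)%N by exact: geq_minl.
have k0kb : (k0 <= kb)%N by exact: geq_minr.
set Nr := fine _.
have Nr0 : 0 <= Nr by rewrite fine_ge0 // sobolev_norm_ge0.
have wd i : (i <= m)%N ->
    is_weak_derivative `]-oo, L[ i u0 (weak_derivative `]-oo, L[ i u0).
  by move=> im; apply: (weak_derivativeP sob); rewrite (leq_trans im).
pose g i := weak_derivative `]-oo, L[ i u0 \_ `]-oo, L[.
have meas i : (i <= m)%N -> measurable_fun `]-oo, L[ (weak_derivative `]-oo, L[ i u0).
  by move=> /wd [[]].
have gg i : (i <= m)%N -> square_integrable (g i).
  by move=> im; have [] := sobolev_norm_energy fin meas im.
have gE i : (i <= m)%N -> l2_energy (g i) <= Nr ^+ 2.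
  by move=> im; have [] := sobolev_norm_energy fin meas im.
have gG i t : (i <= m)%N -> 0 <= cumulative_energy (g i) t <= Nr ^+ 2.
  move=> im; rewrite cumulative_energy_ge0 /=.
  exact: le_trans (cumulative_energy_le t (gg i im)) (gE i im).
pose f i := cell_mean dx (g i).
have f_cont i : (i < m)%N -> continuous (f i).
  by move=> im; apply: cell_mean_continuous => //; apply: gg; exact: ltnW.
have f_deriv i t : (i < m)%N -> t < L -> is_derive t 1 (f i) (f i.+1 t).
  move=> im tL; apply: (is_derive_cell_mean dx0 tL (gg i (ltnW im)) (gg i.+1 im)).
  exact: weak_derivative_succ (wd i (ltnW im)) (wd i.+1 im).
have f_sqr i t : (i <= m)%N -> f i t ^+ 2 <=
    dx^-1 * (cumulative_energy (g i) t - cumulative_energy (g i) (t - dx)).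
  by move=> im; apply: cell_mean_sqr_le => //; exact: gg.
have f_k0 t : t <= L -> `|f k0 t| <= Num.sqrt (2 + 4 * (1 + lambda^-1)) * Nr.
  move=> tL.
  have h : f k0 t ^+ 2 <= 2 * Nr ^+ 2 + 4 * (1 + dx) * Nr ^+ 2.
    apply: (@discrete_sobolev _ (f k0) (f m) (cumulative_energy (g k0))
       (cumulative_energy (g m))).
    - exact: dx0.
    - exact: f_cont.
    - by move=> s st; apply: f_deriv => //; exact: lt_le_trans tL.
    - by move=> s; apply: gG.
    - by move=> s; apply: gG.
    - by move=> s s'; apply: cumulative_energy_mono; exact: gg.
    - by move=> s; apply: f_sqr.
    - by move=> s; apply: f_sqr.
  rewrite -[Nr]ger0_norm // -[in leRHS]sqrtr_sqr -sqrtrM; last first.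
    by rewrite addr_ge0 // mulr_ge0 // addr_ge0 // invr_ge0 ltW.
  rewrite -sqrtr_sqr ler_wsqrtr // (le_trans h) // -mulrDl ler_wpM2r ?sqr_ge0 //.
  by rewrite lerD2l ler_wpM2l // lerD2l.
pose s (n : nat) : R := a * (n%:R * dt).
have s0 n : 0 <= s n.
  by apply: mulr_ge0; [exact: ltW|apply: mulr_ge0; [exact: ler0n|exact: ltW]].
have sS n : s n.+1 = s n + nu * dx by rewrite /s -natr1 /dt /nu; ring.
pose v n := ghost_extension dx J%:Z m f (s n).
have u0L2 := in_L2_square_integrable sob.1.
have cell_L (j : int) : j <= J%:Z -> j%:~R * dx <= L.
  by move=> jJ; rewrite -LJ ler_pM2r // ler_int.
have exact_v n (j : int) : j <= J%:Z ->
    cell_average dx (fun y => u0 (y - s n)) j = v n j.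
  move=> jJ; rewrite (cell_average_translate dx0 (s0 n) (cell_L j jJ)) //; last first.
    exact: square_integrable_interval.
    by case: u0L2.
  rewrite /v /ghost_extension jJ.
  apply: (@eq_cell_mean _ L _ _ _ _ dx0 u0L2 (gg 0%N isT)) => //.
    move=> phi tphi; have [_ /(_ _ tphi)] := wd 0%N isT.
    by rewrite derive1n0 expr0 mul1r !Rintegral_restrict.
  by rewrite lerBlDr (le_trans (cell_L j jJ)) // lerDl.
(* Defining the exact values in the ghost cells by [ghost_extension] makes
   the error a solution of the scheme up to the boundary. *)
pose e n j := u n j - v n j.
pose tau n j := scheme_step r p a_ (v n) j - f 0%N (j%:~R * dx - s n - nu * dx).
pose N := Num.trunc (T / dt).
have TdtN : N%:R <= T / dt by rewrite truncn_le // divr_ge0 ?ltW.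
have stepN n : (n < N)%N -> n%:R <= T / dt - 1.
  by move=> nN; rewrite lerBrDr natr1 (le_trans _ TdtN) // ler_nat.
pose G := K2 * Nr * dx ^+ k0.
pose S := K1 * dx ^+ (2 * k0 + 1) * Nr ^+ 2.
have dxk0 q : 0 <= dx ^+ q by rewrite exprn_ge0 // ltW.
have S0 : 0 <= S by apply: mulr_ge0; [exact: mulr_ge0|exact: sqr_ge0].
have G0 : 0 <= G by apply: mulr_ge0; [exact: mulr_ge0|].
have e_init j : j <= J%:Z -> e 0%N j = 0.
  move=> jJ; rewrite /e u_init // -exact_v //; apply/eqP; rewrite subr_eq0.
  by apply/eqP; congr cell_average; apply/funext => y; rewrite /s mul0r mulr0 subr0.
have e_step n : (n < N)%N -> forall j, j <= J%:Z ->
    e n.+1 j = scheme_step r p a_ (e n) j + tau n j.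
  move=> nN j jJ; rewrite /e u_step ?stepN // /tau.
  have -> : v n.+1 j = f 0%N (j%:~R * dx - s n - nu * dx).
    by rewrite /v /ghost_extension jJ sS opprD addrA.
  rewrite addrA; congr (_ - _); rewrite -scheme_stepD.
  by apply: eq_bigr => l _; rewrite subrK.
have e_ghost n : (n < N)%N -> ghost_values p J%:Z (iter kb D (e n)) <= G.
  move=> nN; rewrite /ghost_values.
  have one (i : 'I_p) : `|iter kb D (e n) (J%:Z + p%:Z - i%:Z)| <=
      2 ^+ kb * (Num.sqrt (2 + 4 * (1 + lambda^-1)) * Nr * ((p + kb)%:R * dx) ^+ k0).
    have ip := ltn_ord i.
    have uz : iter kb D (u n) (J%:Z + p%:Z - i%:Z) = 0.
      have -> : J%:Z + p%:Z - i%:Z = J%:Z + (p - i)%N%:Z by clear -ip; lia.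
      by apply: u_ghost; [exact: stepN|clear -ip; lia].
    have := iter_diffD kb (e n) (v n) (J%:Z + p%:Z - i%:Z).
    rewrite (_ : (fun i => e n i + v n i) = u n); last first.
      by apply/funext => j; rewrite /e subrK.
    rewrite uz => /eqP; rewrite eq_sym addr_eq0 => /eqP ->; rewrite normrN.
    apply: (ghost_difference dx0 LJ f_cont f_deriv (s0 n) _ k0kb _ f_k0) => //.
    - by rewrite mulr_ge0 ?sqrtr_ge0.
    - by clear; lia.
    - by clear -ip; lia.
  rewrite (le_trans (ler_sum _ (fun i _ => one i))) // sumr_const card_ord -[leLHS]mulr_natl.
  rewrite le_eqVlt; apply/orP; left; apply/eqP.
  rewrite /G /K2 [((p + kb)%:R * dx) ^+ k0]exprMn.
  move: (Num.sqrt _) ((p + kb)%:R ^+ k0) (dx ^+ k0) (2 ^+ kb : R) (p%:R : R).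
  by move=> x1 x2 x3 x4 x5; ring.
have tau_S n : (n < N)%N -> forall M, sqnorm J%:Z M (tau n) <= S.
  move=> nN M.
  pose Gm (j : int) := cumulative_energy (g m) (j%:~R * dx - s n).
  have one (i : 'I_M) : tau n (J%:Z - i%:Z) ^+ 2 <=
      A ^+ 2 * ((W%:R * dx) ^+ m) ^+ 2 * dx^-1 *
      (Gm (J%:Z - i%:Z + p%:Z) - Gm (J%:Z - i%:Z + p%:Z - (W + 1 + p)%N%:Z)).
    set j := J%:Z - i%:Z.
    have jJ : j <= J%:Z by rewrite /j; clear; lia.
    set dG := _ - _.
    have dG0 : 0 <= dG.
      rewrite subr_ge0; apply: cumulative_energy_mono; first exact: gg.
      by rewrite cell_le //; clear; lia.
    pose B := Num.sqrt (dx^-1 * dG).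
    have -> : A ^+ 2 * ((W%:R * dx) ^+ m) ^+ 2 * dx^-1 * dG =
        (A * (B * (W%:R * dx) ^+ m)) ^+ 2.
      rewrite [in RHS]exprMn [(B * _) ^+ 2]exprMn sqr_sqrtr.
        move: (A ^+ 2) (((W%:R * dx) ^+ m) ^+ 2) (dx^-1) (dG) => x1 x2 x3 x4.
        ring.
      by rewrite mulr_ge0 // invr_ge0 ltW.
    rewrite -[tau n j ^+ 2]real_normK ?num_real //.
    rewrite ler_sqr ?nnegrE //; last first.
      rewrite mulr_ge0 ?addr_ge0 ?coef_norm_ge0 // mulr_ge0 ?sqrtr_ge0 //.
      by rewrite exprn_ge0 // mulr_ge0 ?ler0n // ltW.
    apply: (truncation_error (ltW nu0) moments dx0 LJ _ f_cont f_deriv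
      (s0 n) jJ prW pnW) => //.
      exact: sqrtr_ge0.
    move=> t /andP[t1 t2] _; rewrite -sqrtr_sqr ler_wsqrtr //.
    rewrite (le_trans (f_sqr m t (leqnn _))) //.
    rewrite ler_wpM2l ?invr_ge0 ?(ltW dx0) // /dG lerB //.
      by apply: cumulative_energy_mono => //; exact: gg.
    apply: cumulative_energy_mono; first exact: gg.
    have -> : (j + p%:Z - (W + 1 + p)%N%:Z)%:~R * dx - s n = (j - W%:Z)%:~R * dx - s n - dx.
      have -> : j + p%:Z - (W + 1 + p)%N%:Z = j - W%:Z - 1 by clear; lia.
      by rewrite [(j - W%:Z - 1)%:~R]rmorphB /=; ring.
    by rewrite lerD2r.
  rewrite /sqnorm (le_trans (ler_sum _ (fun i _ => one i))) // -mulr_sumr.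
  have sw := @sum_window_le R Gm (Nr ^+ 2) J%:Z p%:Z (W + 1 + p) M (fun j => gG m _ (leqnn _)).
  rewrite (le_trans (ler_wpM2l _ sw)) //.
    apply: mulr_ge0; last by rewrite invr_ge0 ltW.
    by apply: mulr_ge0; exact: sqr_ge0.
  rewrite le_eqVlt; apply/orP; left; apply/eqP.
  rewrite /S /K1 exprMn exprMn -!exprM [(m * 2)%N]mulnC.
  have -> : dx ^+ (2 * m) = dx ^+ (2 * k0 + 1) * dx.
    by rewrite -exprSr; congr (dx ^+ _); rewrite /m; clear; lia.
  have dxn0 : dx != 0 by rewrite lt0r_neq0.
  by field.
move=> n nT M.
have nN : (n <= N)%N.
  by rewrite /N truncn_ge_nat // divr_ge0 ?ltW.
have -> : sqnorm J%:Z M (err n) = sqnorm J%:Z M (e n).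
  by apply: eq_sqnorm => j jJ; rewrite /err /e -exact_v.
have := stab J%:Z N e tau G S S0 G0 e_init e_step e_ghost tau_S n nN M.
move=> /(ler_wpM2l (ltW dx0)) /le_trans; apply.
pose q := dx * N%:R; pose P := (dx ^+ k0) ^+ 2 * Nr ^+ 2.
have P0 : 0 <= P by apply: mulr_ge0; exact: sqr_ge0.
have q0 : 0 <= q by rewrite mulr_ge0 ?ler0n ?(ltW dx0).
have qT : q <= T / lambda.
  rewrite /q mulrC -ler_pdivlMr // (le_trans TdtN) // /dt invfM mulrA.
  by [].
have -> : dx * (Cs * (N%:R * G ^+ 2 + N%:R ^+ 2 * S)) =
    Cs * (q * K2 ^+ 2 + q ^+ 2 * K1) * P.
  rewrite /G /S /q /P exprD expr1 exprM [dx ^+ 2 ^+ k0]exprAC.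
  ring.
have -> : (Num.sqrt (Cs * K + 1) * (Num.sqrt T + T) * dx ^+ k0 * Nr) ^+ 2 =
    (Cs * K + 1) * (Num.sqrt T + T) ^+ 2 * P.
  have CsK0 : 0 <= Cs * K + 1 by rewrite addr_ge0 // mulr_ge0.
  rewrite -[in RHS](sqr_sqrtr CsK0) /P.
  by move: (Num.sqrt (Cs * K + 1)) (Num.sqrt T + T) (dx ^+ k0) => x1 x2 x3; ring.
rewrite ler_wpM2r //.
have sT : Num.sqrt T ^+ 2 = T by rewrite sqr_sqrtr // ltW.
have sT0 : 0 <= Num.sqrt T by exact: sqrtr_ge0.
set X := (Num.sqrt T + T) ^+ 2.
have TX : T <= X by rewrite /X -[leLHS]sT ler_sqr ?nnegrE ?addr_ge0 ?(ltW T0) // lerDl ltW.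
have T2X : T ^+ 2 <= X by rewrite /X ler_sqr ?nnegrE ?addr_ge0 ?(ltW T0) // lerDr.
have X0 : 0 <= X by exact: sqr_ge0.
have h1 : q * K2 ^+ 2 <= K2 ^+ 2 / lambda * X.
  rewrite mulrC -mulrA ler_wpM2l ?sqr_ge0 // (le_trans qT) // mulrC.
  by rewrite ler_wpM2l // invr_ge0 ltW.
have h2 : q ^+ 2 * K1 <= K1 / lambda ^+ 2 * X.
  rewrite mulrC -mulrA ler_wpM2l //.
  have qT2 : q ^+ 2 <= (T / lambda) ^+ 2.
    by rewrite ler_sqr ?nnegrE // divr_ge0 ?ltW.
  by rewrite (le_trans qT2) // expr_div_n mulrC ler_wpM2l // invr_ge0 exprn_ge0 // ltW.
have h3 : Cs * (q * K2 ^+ 2 + q ^+ 2 * K1) <= Cs * (K * X).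
  rewrite ler_wpM2l // (_ : K * X = K2 ^+ 2 / lambda * X + K1 / lambda ^+ 2 * X).
    exact: lerD.
  exact: mulrDl.
by rewrite (le_trans h3) // mulrA ler_wpM2r // lerDl.
Qed.

End Convergence.

Section ExtendedReals.
Variable R : realType.

Lemma esum_cells_le (J : int) (w : int -> R) (dx B : R) : 0 <= dx ->
  (forall M, dx * sqnorm J M w <= B) ->
  (\esum_(j in [set j : int | (j <= J)%R]) (dx * w j ^+ 2)%:E <= B%:E)%E.
Proof.
move=> dx0 wB.
have bij : set_bij [set: nat] [set j : int | j <= J] (fun i : nat => J - i%:Z).
  split=> [i _|i i' _ _|j jJ] /=; [lia|lia|].
  by exists (absz (J - j)%R) => //; move: jJ => /=; lia.
have a0 (i : nat) : (0 <= (dx * w (J - i%:Z) ^+ 2)%:E)%E.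
  by rewrite lee_fin mulr_ge0 // sqr_ge0.
rewrite (reindex_esum _ _ _ _ bij) -(nneseries_esumT a0).
apply: lime_le; first by apply: is_cvg_nneseries => i _ _; exact: a0.
apply: nearW => M; rewrite sumEFin lee_fin (le_trans _ (wB M)) //.
by rewrite /sqnorm mulr_sumr big_mkord.
Qed.

Lemma entry_le_sqnorm (J j : int) (w : int -> R) : j <= J ->
  w j ^+ 2 <= sqnorm J (absz (J - j)%R).+1 w.
Proof.
move=> jJ; rewrite /sqnorm big_ord_recr /=.
rewrite (_ : J - `|J - j|%N%:Z = j); last by move: jJ; lia.
by rewrite lerDr; apply: sumr_ge0 => i _; exact: sqr_ge0.
Qed.

Lemma poweR_half_le (x : \bar R) (B : R) : (0 <= x)%E -> 0 <= B ->
  (x <= (B ^+ 2)%:E -> x `^ 2^-1 <= B%:E)%E.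
Proof.
move=> x0 B0 xB; have -> : B = (B ^+ 2) `^ 2^-1.
  by rewrite powR12_sqrt ?sqr_ge0 // sqrtr_sqr ger0_norm.
rewrite -poweR_EFin; apply: gt0_ler_poweR => //.
  by rewrite in_itv /= x0 leey.
by rewrite in_itv /= lee_fin sqr_ge0 leey.
Qed.

Lemma powR_subhalf (x : R) (n : nat) : 0 < x ->
  x `^ (n%:R - 2^-1) = x ^+ n / Num.sqrt x.
Proof.
move=> x0; rewrite powRD; last by rewrite lt0r_neq0 ?implybT.
by rewrite powR_mulrn ?(ltW x0) // powRN powR12_sqrt // ltW.
Qed.

End ExtendedReals.

Theorem theorem3p5 (R : realType) (a lambda : R) (k kb r p : nat)
    (a_ : int -> R) :
  0 < a -> 0 < lambda -> (1 <= k)%N -> (1 <= r)%N -> (1 <= p)%N ->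
  a_ (- r%:Z) * a_ p%:Z != 0 ->
  (forall m : nat, (m <= k)%N ->
     \sum_(l <- stencil r p) l%:~R ^+ m * a_ l = (- (lambda * a)) ^+ m) ->
  (ereal_sup [set (ComplexField.Normc.normc (symbol r p a_ theta))%:E
             | theta in `[0%R, (2 * pi)%R]] <= 1)%E ->
  let k0 := minn k kb in
  exists2 C : R, 0 < C &
    forall (T : R) (J : nat) (L : R) (u0 : R -> R),
      0 < T -> (1 <= J)%N -> 1 <= L ->
      in_sobolev `]-oo, L[ k.+1 u0 ->
      let dx := L / J%:R in
      let dt := lambda * dx in
      dt < 1 ->
      forall u : nat -> int -> R,
        scheme_solution kb r p a_ T dt dx J u0 u ->
        let err (n : nat) (j : int) :=
          u n j - cell_average dx (fun y => u0 (y - a * (n%:R * dt))) j in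
        let times := [set n : nat | n%:R <= T / dt] in
        let cells := [set j : int | j <= J%:Z] in
        (ereal_sup [set ((\esum_(j in cells) (dx * err n j ^+ 2)%:E) `^ 2^-1)%E
                   | n in times]
         <= (C * (Num.sqrt T + T) * dx ^+ k0)%:E
            * sobolev_norm `]-oo, L[ k0.+1 u0)%E /\
        (ereal_sup [set ereal_sup [set `|err n j|%:E | j in cells] | n in times]
         <= (C * (Num.sqrt T + T) * dx `^ (k0%:R - 2^-1))%:E
            * sobolev_norm `]-oo, L[ k0.+1 u0)%E.
Proof.
move=> a0 lambda0 k0' r0 p0 arp moments sup k0.
have symb theta : 0 <= theta <= 2 * pi ->
    ComplexField.Normc.normc (symbol r p a_ theta) <= 1.
  move=> th; rewrite -lee_fin (le_trans _ sup) //; apply: ereal_sup_ubound.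
  by exists theta => //=; rewrite in_itv.
have ar0 : a_ (- r%:Z) != 0 by move: arp; rewrite mulf_eq0 negb_or => /andP[].
have [C C0 HC] := l2_convergence kb a0 lambda0 k0' r0 ar0 moments symb.
exists C => // T J L u0 T0 J1 L1 sob dx dt dt1 u sol err times cells.
have L0 : 0 < L by exact: lt_le_trans ltr01 L1.
have JR : 0 < J%:R :> R by rewrite ltr0n.
have dx0 : 0 < dx by rewrite divr_gt0.
set X := C * (Num.sqrt T + T).
have X0 : 0 < X by rewrite mulr_gt0 // ltr_wpDl ?sqrtr_ge0.
have [fin|] := boolP (sobolev_norm `]-oo, L[ k0.+1 u0 < +oo)%E; last first.
  rewrite -leNgt leye_eq => /eqP ->; rewrite !gt0_muley ?lte_fin.
  - by split; exact: leey.
  - by rewrite mulr_gt0 // powR_gt0.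
  - by rewrite mulr_gt0 // exprn_gt0.
have fin_num : sobolev_norm `]-oo, L[ k0.+1 u0 \is a fin_num.
  by rewrite ge0_fin_numE // sobolev_norm_ge0.
set Nr := fine (sobolev_norm `]-oo, L[ k0.+1 u0).
have Nr0 : 0 <= Nr by rewrite fine_ge0 // sobolev_norm_ge0.
rewrite -(fineK fin_num) -/Nr.
have bound n : times n -> forall M,
    dx * sqnorm J%:Z M (err n) <= (X * dx ^+ k0 * Nr) ^+ 2.
  by move=> nT M; exact: (HC T J L u0 T0 J1 L0 sob fin dt1 u sol n nT M).
have B0 : 0 <= X * dx ^+ k0 * Nr.
  by rewrite mulr_ge0 // mulr_ge0 ?exprn_ge0 // ltW.
split; rewrite -EFinM; apply: ge_ereal_sup => _ [n nT <-].
  apply: poweR_half_le => //; last exact: esum_cells_le (ltW dx0) (bound n nT).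
  by apply: esum_ge0 => j _; rewrite lee_fin mulr_ge0 ?sqr_ge0 // ltW.
apply: ge_ereal_sup => _ [j jJ <-]; rewrite lee_fin powR_subhalf //.
have sdx : 0 < Num.sqrt dx by rewrite sqrtr_gt0.
have e0 : 0 <= `|err n j| * Num.sqrt dx by rewrite mulr_ge0 // ltW.
rewrite mulrA mulrAC ler_pdivlMr // -ler_sqr ?nnegrE //.
rewrite exprMn sqr_sqrtr ?(ltW dx0) // real_normK ?num_real //.
apply: le_trans (bound n nT (absz (J%:Z - j)%R).+1).
by rewrite mulrC ler_wpM2l ?(ltW dx0) // entry_le_sqnorm.
Qed.
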